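(* Let $(\mathfrak{g},\eta)$ be a $5$-dimensional DS-contact Lie algebra with trivial center. Then $\mathfrak{g}$ is isomorphic to exactly one of the following Lie algebras, each with basis $\{\xi,x,y,u,v\}$ and nonzero brackets (up to skew-symmetry) as given: (i) $\mathfrak{g}_{0,+}$: $[x,y]=\xi+y$, $[u,v]=\xi$, $[\xi,u]=v$, $[\xi,v]=-u$, $[y,u]=-v$, $[y,v]=u$. (ii) $\mathfrak{g}_{1,+}$: $[x,y]=\xi+y$, $[u,v]=\xi$, $[\xi,u]=u$, $[\xi,v]=-v$, $[y,u]=-u$, $[y,v]=v$. (iii) $\mathfrak{g}_{0,-}$: $[x,y]=\xi+y$, $[u,v]=\xi+y$, $[\xi,u]=v$, $[\xi,v]=-u$, $[x,u]=\tfrac12u$, $[x,v]=\tfrac12v$, $[y,u]=-v$, $[y,v]=u$. (iv) $\mathfrak{g}_{1,-}$: $[x,y]=\xi+y$, $[u,v]=\xi+y$, $[\xi,u]=u$, $[\xi,v]=-v$, $[x,u]=\tfrac12u$, $[x,v]=\tfrac12v$, $[y,u]=-u$, $[y,v]=v$.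
   Context: All Lie algebras are real and finite-dimensional. A contact Lie algebra is a pair $(\mathfrak{g},\eta)$ with $\dim\mathfrak{g}=2n+1$ and $\eta\in\mathfrak{g}^*$ such that $\eta\wedge(d\eta)^n\neq 0$, where $d\eta(x,y)=-\eta([x,y])$. Its Reeb vector is the unique $\xi\in\mathfrak{g}$ with $\eta(\xi)=1$ and $d\eta(\xi,\cdot)=0$. $(\mathfrak{g},\eta)$ is DS-contact if $\mathfrak{g}=\ker\operatorname{ad}_\xi\oplus\operatorname{im}\operatorname{ad}_\xi$ as vector spaces. *)

(* Defs.v *)
From HB Require Import structures.
From mathcomp Require Import all_boot all_order all_algebra all_fingroup.
From mathcomp Require Import reals.
From mathcomp Require Import ring.

Set Implicit Arguments.
Unset Strict Implicit.
Unset Printing Implicit Defensive.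

Import GRing.Theory Num.Theory.
Local Open Scope ring_scope.

HB.mixin Record Vector_isLieAlgebra (K : fieldType) V of Vector K V := {
  bracket : V -> V -> V;
  bracketDZl : forall (c : K) (a b z : V),
    bracket (c *: a + b) z = c *: bracket a z + bracket b z;
  bracketDZr : forall (c : K) (z a b : V),
    bracket z (c *: a + b) = c *: bracket z a + bracket z b;
  bracketxx : forall a : V, bracket a a = 0;
  jacobi : forall a b c : V,
    bracket a (bracket b c) + bracket b (bracket c a)
      + bracket c (bracket a b) = 0
}.

#[short(type="lieAlgType")]
HB.structure Definition LieAlgebra (K : fieldType) :=
  { V of Vector_isLieAlgebra K V & Vector K V }.

Section LieTheory.
Variables (K : fieldType) (g h : lieAlgType K).

HB.instance Definition _ (a : g) :=
  GRing.isLinear.Build K g g *:%R (bracket a)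
    (fun c u v => bracketDZr c a u v).

Definition ad (a : g) : 'End(g) := linfun (bracket a).

Definition trivial_center : Prop :=
  forall z : g, (forall a : g, bracket z a = 0) -> z = 0.

Definition lie_isomorphic : Prop :=
  exists f : 'Hom(g, h),
    bijective f /\ forall a b : g, f (bracket a b) = bracket (f a) (f b).

End LieTheory.

(* A k-form is represented by its underlying function of k vectors; the forms *)
(* built below from a linear form are multilinear and alternating.            *)
Section Forms.
Variables (K : numFieldType) (V : vectType K).

Definition form (k : nat) := ('I_k -> V) -> K.

Definition wedge (p q : nat) (a : form p) (b : form q) : form (p + q) :=
  fun w => (p`! * q`!)%:R^-1 *
    \sum_(s : 'S_(p + q))
      (-1) ^+ s * a (fun i => w (s (lshift q i))) * b (fun j => w (s (rshift p j))).

(* The type is well formed because k.+1 * 2 is convertible to 2 + k * 2.      *)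
Fixpoint wedge_pow2 (b : form 2) (k : nat) : form (k * 2) :=
  match k return form (k * 2) with
  | 0 => fun _ => 1
  | k'.+1 => wedge b (@wedge_pow2 b k')
  end.

Definition form1 (eta : 'Hom(V, K^o)) : form 1 := fun w => eta (w ord0).

End Forms.

Arguments wedge_pow2 {K V} b k _ : rename.

Section Contact.
Variables (K : numFieldType) (g : lieAlgType K).

Definition dform (eta : 'Hom(g, K^o)) (a b : g) : K := - eta (bracket a b).

Definition dform2 (eta : 'Hom(g, K^o)) : form g 2 :=
  fun w => dform eta (w ord0) (w ord_max).

Definition contact (eta : 'Hom(g, K^o)) : Prop :=
  exists n : nat, \dim {:g} = (2 * n + 1)%N /\
    exists w, wedge (form1 eta) (wedge_pow2 (dform2 eta) n) w != 0.

Definition is_reeb (eta : 'Hom(g, K^o)) (xi : g) : Prop :=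
  eta xi = 1 /\ forall a : g, dform eta xi a = 0.

(* For a contact form the Reeb vector exists and is unique, so that the       *)
(* existential quantifier over xi designates it.                              *)
Definition DS_contact (eta : 'Hom(g, K^o)) : Prop :=
  contact eta /\
  exists xi : g, is_reeb eta xi /\
    (lker (ad xi) + limg (ad xi))%VS = fullv /\
    directv (lker (ad xi) + limg (ad xi)).

End Contact.

Variant ds_model := g0_plus | g1_plus | g0_minus | g1_minus.

Section Models.
Variable K : numFieldType.

Let xi : 'I_5 := inord 0.
Let x : 'I_5 := inord 1.
Let y : 'I_5 := inord 2.
Let u : 'I_5 := inord 3.
Let v : 'I_5 := inord 4.
Let e (i : 'I_5) : 'rV[K]_5 := delta_mx 0 i.

(* An entry (i, j, z) stands for [e i, e j] = z; brackets of basis vectors    *)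
(* that follow from no entry by skew-symmetry are zero.                       *)
Definition ds_table (m : ds_model) : seq ('I_5 * 'I_5 * 'rV[K]_5) :=
  match m with
  | g0_plus =>
    [:: (x, y, e xi + e y); (u, v, e xi);
        (xi, u, e v); (xi, v, - e u); (y, u, - e v); (y, v, e u)]
  | g1_plus =>
    [:: (x, y, e xi + e y); (u, v, e xi);
        (xi, u, e u); (xi, v, - e v); (y, u, - e u); (y, v, e v)]
  | g0_minus =>
    [:: (x, y, e xi + e y); (u, v, e xi + e y);
        (xi, u, e v); (xi, v, - e u);
        (x, u, 2^-1 *: e u); (x, v, 2^-1 *: e v); (y, u, - e v); (y, v, e u)]
  | g1_minus =>
    [:: (x, y, e xi + e y); (u, v, e xi + e y);
        (xi, u, e u); (xi, v, - e v);
        (x, u, 2^-1 *: e u); (x, v, 2^-1 *: e v); (y, u, - e u); (y, v, e v)]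
  end.

(* Skew-symmetric bilinear extension of the table, which lists each unordered *)
(* pair of basis vectors at most once.                                        *)
Definition table_bracket (s : seq ('I_5 * 'I_5 * 'rV[K]_5)) (a b : 'rV[K]_5) :
    'rV[K]_5 :=
  \sum_(t <- s)
    (a 0 t.1.1 * b 0 t.1.2 - a 0 t.1.2 * b 0 t.1.1) *: t.2.

Lemma table_bracketDZl s (c : K) a b z :
  table_bracket s (c *: a + b) z = c *: table_bracket s a z + table_bracket s b z.
Proof.
rewrite /table_bracket scaler_sumr -big_split /=; apply: eq_bigr => t _.
by rewrite !mxE scalerA -scalerDl; congr (_ *: _); ring.
Qed.

Lemma table_bracketDZr s (c : K) z a b :
  table_bracket s z (c *: a + b) = c *: table_bracket s z a + table_bracket s z b.
Proof.
rewrite /table_bracket scaler_sumr -big_split /=; apply: eq_bigr => t _.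
by rewrite !mxE scalerA -scalerDl; congr (_ *: _); ring.
Qed.

Lemma table_bracketxx s a : table_bracket s a a = 0.
Proof.
by rewrite /table_bracket big1 // => t _; rewrite mulrC subrr scale0r.
Qed.

Lemma ds_bracketE m a b (br := table_bracket (ds_table m) a b)
    (d := fun i j => a 0 i * b 0 j - a 0 j * b 0 i) :
  let h : K := match m with g0_plus | g1_plus => 0 | _ => 2^-1 end in
  let c : K := match m with g0_plus | g1_plus => 0 | _ => 1 end in
  let r : K := match m with g0_plus | g0_minus => 1 | _ => 0 end in
  [/\ br 0 xi = d x y + d u v, br 0 x = 0, br 0 y = d x y + c * d u v,
      br 0 u = r * (d y v - d xi v) + (1 - r) * (d xi u - d y u) + h * d x u &
      br 0 v = r * (d xi u - d y u) + (1 - r) * (d y v - d xi v) + h * d x v].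
Proof.
have Ev (i j : 'I_5) : (i == j) = (i == j :> nat) by [].
rewrite /br /d {br d} /table_bracket.
case: m; split; rewrite !big_cons !big_nil /= /e !mxE !Ev
  !inordK //= ?mulr1n ?mulr0n.
all: by try (move: (2^-1) => q); ring.
Qed.

Lemma ds_jacobi m a b c :
  let br := table_bracket (ds_table m) in
  br a (br b c) + br b (br c a) + br c (br a b) = 0.
Proof.
have case5 (k : 'I_5) : [\/ k = xi, k = x, k = y | k = u \/ k = v].
  have E n : (n < 5)%N -> nat_of_ord k = n -> k = inord n.
    by move=> ? kn; apply: val_inj; rewrite /= inordK.
  case: k E => -[|[|[|[|[|//]]]]] Hk E.
  - exact/Or41/E.
  - exact/Or42/E.
  - exact/Or43/E.
  - by apply: Or44; left; apply: E.
  - by apply: Or44; right; apply: E.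
rewrite /=; apply/rowP => k; rewrite !mxE.
have [a1 a2 a3 a4 a5] := ds_bracketE m a (table_bracket (ds_table m) b c).
have [b1 b2 b3 b4 b5] := ds_bracketE m b (table_bracket (ds_table m) c a).
have [c1 c2 c3 c4 c5] := ds_bracketE m c (table_bracket (ds_table m) a b).
have [d1 d2 d3 d4 d5] := ds_bracketE m b c.
have [e1 e2 e3 e4 e5] := ds_bracketE m c a.
have [f1 f2 f3 f4 f5] := ds_bracketE m a b.
case: (case5 k) => [->|->|->|[->|->]].
all: rewrite ?(a1, a2, a3, a4, a5, b1, b2, b3, b4, b5, c1, c2, c3, c4, c5)
  ?(d1, d2, d3, d4, d5, e1, e2, e3, e4, e5, f1, f2, f3, f4, f5)
  {a1 a2 a3 a4 a5 b1 b2 b3 b4 b5 c1 c2 c3 c4 c5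
   d1 d2 d3 d4 d5 e1 e2 e3 e4 e5 f1 f2 f3 f4 f5}.
all: by case: m; field.
Qed.

Definition ds_alg (m : ds_model) : Type := 'rV[K]_5.

HB.instance Definition _ m := Vector.on (ds_alg m).
HB.instance Definition _ m := Vector_isLieAlgebra.Build K (ds_alg m)
  (@table_bracketDZl (ds_table m)) (@table_bracketDZr (ds_table m))
  (@table_bracketxx (ds_table m)) (@ds_jacobi m).

End Models.

(* Main.v *)
From HB Require Import structures.
Require Import Defs.
From mathcomp Require Import all_boot all_order all_algebra all_fingroup.
From mathcomp Require Import boolp reals complex ring zify.

Set Implicit Arguments.
Unset Strict Implicit.
Unset Printing Implicit Defensive.

Import Order.TTheory GRing.Theory Num.Theory.
Local Open Scope ring_scope.

(** Let T = ad xi, let N be its kernel and P its image, and let omega = d eta.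
    The contact condition says that no nonzero z satisfies both eta z = 0 and
    omega(z, .) = 0 ([contact_nondegenerate]).  Since eta o T = 0, the Jacobi
    identity makes T skew for omega; hence N and P are omega-orthogonal, so
    omega is nondegenerate on P and on N modulo xi, and these spaces have even
    dimension: dim N is 1, 3 or 5.

    Dimension 5 would make xi central.  Dimension 1 is the hard case to
    exclude ([reeb_kernel_not_line]): then xi spans a one-dimensional Cartan
    subalgebra.  Over the complex numbers g splits into the generalized
    eigenspaces g_a of T, with [g_a, g_b] inside g_(a+b), with g_0 spanned by
    xi, and with g_a and g_(-a) paired by omega.  A weight a <> 0 such that
    2a is not a weight has a one-dimensional eigenspace; dimension 5 then forces
    the weights to be 0, a, -a, b, -b, all simple, and two instances of the Jacobi
    identity contradict each other.

    In dimension 3, N acts on the plane P by operators commuting with T, thus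
    by combinations of 1 and T.  If n, m complete xi to a basis of N, the
    bracket w = [n, m] kills P, and N contains an x with [x, w] = w which acts
    on P as a scalar h.  In P one finds u with u, v = T u independent, and then
    T v = d u.  The Jacobi identity leaves [u, v] = c xi with h = 0, or
    [u, v] = m w with h = 1/2 ([ds_split_form]).  In the first case g is the
    sum of the two-dimensional nonabelian algebra and of span(xi, u, v), which
    is so(3) or sl(2) according to the signs of d and c; in the second g is an
    extension of the Heisenberg algebra span(u, v, w) by span(xi, x), and only
    the sign of d matters.  Rescaling yields the four models
    ([split_form_ds_model]), with y = w - xi.

    The models are told apart by two invariants ([ds_alg_injective]): whether
    the derived algebra is nilpotent of class at most 2, and whether some ad a
    has both eigenvalues 1 and -1. *)

(** * Identities in Lie algebras *)

Section BracketExpansion.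
Variables (K : fieldType) (g : lieAlgType K).
Implicit Types (a b c : g) (k : K).

Lemma bracketC a b : bracket a b = - bracket b a.
Proof.
apply/eqP; rewrite -addr_eq0; apply/eqP.
have lin c d f : bracket (c + d) f = bracket c f + bracket d f.
  by rewrite -[c in LHS]scale1r bracketDZl scale1r.
by have := bracketxx (a + b); rewrite lin !raddfD /= !bracketxx add0r addr0.
Qed.

Lemma bracketDr a b c : bracket c (a + b) = bracket c a + bracket c b.
Proof. exact: raddfD. Qed.

Lemma bracketNr a b : bracket b (- a) = - bracket b a.
Proof. exact: raddfN. Qed.

Lemma bracketZr k a b : bracket b (k *: a) = k *: bracket b a.
Proof. exact: linearZ. Qed.

Lemma bracket0r a : bracket a 0 = 0.
Proof. exact: raddf0. Qed.

Lemma bracketDl a b c : bracket (a + b) c = bracket a c + bracket b c.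
Proof. by rewrite ![bracket _ c]bracketC bracketDr opprD. Qed.

Lemma bracketNl a b : bracket (- a) b = - bracket a b.
Proof. by rewrite ![bracket _ b]bracketC bracketNr. Qed.

Lemma bracketZl k a b : bracket (k *: a) b = k *: bracket a b.
Proof. by rewrite ![bracket _ b]bracketC bracketZr scalerN. Qed.

Lemma bracket0l a : bracket 0 a = 0.
Proof. by rewrite bracketC bracket0r oppr0. Qed.

Definition bracketE := (bracketDl, bracketDr, bracketNl, bracketNr,
  bracketZl, bracketZr, bracket0l, bracket0r).

Lemma bracket_ad a b c :
  bracket (bracket a b) c = bracket a (bracket b c) - bracket b (bracket a c).
Proof.
apply/eqP; rewrite eqtype.eq_sym -subr_eq0 [X in _ - X]bracketC opprK.
by rewrite [bracket a c]bracketC bracketNr opprK jacobi.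
Qed.

Lemma bracket_der a b c :
  bracket a (bracket b c) = bracket (bracket a b) c + bracket b (bracket a c).
Proof. by rewrite bracket_ad subrK. Qed.

End BracketExpansion.

(** Turns an identity between linear combinations of vectors into one between
    scalars, where [ring] and [field] apply. *)
Lemma vector_eq (K : fieldType) (V : vectType K) (a b : V) :
  (forall phi : V -> K, {morph phi : x y / x + y} -> {morph phi : x / - x} ->
     (forall k x, phi (k *: x) = k * phi x) -> phi 0 = 0 -> phi a = phi b) ->
  a = b.
Proof.
move=> eq_ab; have Xb := vbasisP {:V}.
rewrite (coord_basis Xb (memvf a)) (coord_basis Xb (memvf b)).
apply: eq_bigr => i _; congr (_ *: _).
apply: eq_ab => [x y|x|k x|]; [exact: raddfD|exact: raddfN|exact: linearZ|exact: raddf0].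
Qed.

Ltac vector_coordinates :=
  apply: vector_eq;
  let phi := fresh "phi" in let D := fresh "D" in let N := fresh "N" in
  let Z := fresh "Z" in let O := fresh "O" in
  intros phi D N Z O; rewrite ?(D, N, Z, O).

(** * Nondegeneracy of contact forms *)

Section MultilinearForms.
Variables (K : numFieldType) (V : vectType K).
Implicit Types (k p q : nat) (z : V).

Definition update k (w : 'I_k -> V) (i : 'I_k) (z : V) : 'I_k -> V :=
  fun j => if j == i then z else w j.

Definition multilinear k (f : Defs.form V k) : Prop := forall w i c z z',
  f (update w i (c *: z + z')) = c * f (update w i z) + f (update w i z').

Definition alternating k (f : Defs.form V k) : Prop :=
  forall w i j, i != j -> w i = w j -> f w = 0.

Definition vanishes_at k (f : Defs.form V k) z : Prop :=
  forall w i, w i = z -> f w = 0.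

Lemma update_id k (w : 'I_k -> V) i : update w i (w i) = w.
Proof. by apply: funext => j; rewrite /update; case: eqP => [->|]. Qed.

Lemma update_comp k l (w : 'I_k -> V) (f : 'I_l -> 'I_k) i z : injective f ->
  (fun j => update w (f i) z (f j)) = update (w \o f) i z.
Proof.
by move=> f_inj; apply: funext => j; rewrite /update (inj_eq f_inj).
Qed.

Lemma update_notin k l (w : 'I_k -> V) (f : 'I_l -> 'I_k) i z :
  (forall j, f j != i) -> (fun j => update w i z (f j)) = w \o f.
Proof. by move=> fi; apply: funext => j; rewrite /update (negPf (fi j)). Qed.

(** If [f w] is nonzero then [w] is a basis: substituting a linear combination
    of the entries of [w] for one of them multiplies [f w] by a coefficient of
    the combination.  Expanding [z] in this basis and substituting it at the
    place of a nonzero coefficient gives a contradiction. *)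
Lemma top_form_vanishes k (f : Defs.form V k) z : \dim {:V} = k ->
  multilinear f -> alternating f -> vanishes_at f z -> z != 0 ->
  forall w, f w = 0.
Proof.
move=> dimV f_lin f_alt fz z0 w; apply/eqP/contraT => fw.
have f0 i : f (update w i 0) = 0.
  by have := f_lin w i (-1) 0 0; rewrite scaler0 addr0 mulN1r addNr.
have fsum i (c : 'I_k -> K) : f (update w i (\sum_j c j *: w j)) = c i * f w.
  rewrite (bigD1 i) //= f_lin update_id; rewrite -[RHS]addr0; congr (_ + _).
  apply: (big_ind (fun x => f (update w i x) = 0)) => [|x y fx fy|j ji].
  - exact: f0.
  - by rewrite -[x]scale1r f_lin fx fy mulr0 addr0.
  rewrite -[_ *: _]addr0 f_lin f0 addr0 (f_alt _ i j) ?mulr0 // 1?eq_sym //.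
  by rewrite /update eqxx (negPf ji).
pose X := [tuple w i | i < k].
have XE (c : 'I_k -> K) : \sum_(i < k) c i *: X`_i = \sum_i c i *: w i.
  by apply: eq_bigr => i _; rewrite -tnth_nth tnth_mktuple.
have Xfree : free X.
  apply/freeP => c; rewrite XE => c0 i.
  by apply/eqP; have /eqP := fsum i c; rewrite c0 f0 eq_sym mulf_eq0 (negPf fw) orbF.
have Xbasis : basis_of fullv X.
  by rewrite basisEfree Xfree subvf dimV size_tuple leqnn.
have zE := coord_basis Xbasis (memvf z).
case/negP: z0; rewrite zE; apply/eqP/big1 => i _.
have /eqP := fsum i (coord X ^~ z).
rewrite -XE -zE (fz _ i); last by rewrite /update eqxx.
by rewrite eq_sym mulf_eq0 (negPf fw) orbF => /eqP ->; rewrite scale0r.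
Qed.

(** Reindexing the sum over permutations by the transposition of the two places
    changes its sign and nothing else. *)
Lemma wedge_alternating p q (a : Defs.form V p) (b : Defs.form V q) :
  alternating (wedge a b).
Proof.
move=> w i j ij wij; rewrite /wedge; apply/eqP; rewrite mulf_eq0; apply/orP; right.
set S := (X in X == 0).
have w_t m : w (tperm i j m) = w m by case: tpermP => [->|->|].
suff : S = - S by move/eqP; rewrite -addr_eq0 -mulr2n mulrn_eq0.
rewrite {1}/S (reindex_inj (mulIg (tperm i j))) /= -sumrN.
apply: eq_bigr => s _; rewrite odd_permM odd_tperm ij addbT signrN !mulNr.
congr (- (_ * a _ * b _)); apply: funext => k; by rewrite permM w_t.
Qed.

Lemma wedge_index p q (s : {perm 'I_(p + q)}) i :
  (exists j, i = s (lshift q j)) \/ (exists j, i = s (rshift p j)).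
Proof.
rewrite -(permKV s i); case: (split_ordP (s^-1%g i)) => j ->; [left|right];
  by exists j.
Qed.

Lemma wedge_vanishes_at p q (a : Defs.form V p) (b : Defs.form V q) z :
  vanishes_at a z -> vanishes_at b z -> vanishes_at (wedge a b) z.
Proof.
move=> az bz w i wi; rewrite /wedge big1 ?mulr0 // => s _.
case: (wedge_index s i) => -[j ij]; rewrite ij in wi.
  by rewrite (az _ j wi) mulr0 mul0r.
by rewrite (bz _ j wi) mulr0.
Qed.

Lemma wedge_multilinear p q (a : Defs.form V p) (b : Defs.form V q) :
  multilinear a -> multilinear b -> multilinear (wedge a b).
Proof.
move=> a_lin b_lin w i c z z'; rewrite /wedge.
rewrite mulrCA -mulrDr; congr (_ * _); rewrite mulr_sumr -big_split /=.
apply: eq_bigr => s _.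
have lK : injective (fun j => s (lshift q j)) by move=> j k /perm_inj /lshift_inj.
have rK : injective (fun j => s (rshift p j)) by move=> j k /perm_inj /rshift_inj.
case: (wedge_index s i) => -[j ->].
  have out m : s (rshift p m) != s (lshift q j).
    by rewrite (inj_eq perm_inj) eq_rlshift.
  rewrite !(update_comp w j _ lK) !(update_notin w _ out) a_lin.
  by move: (_ ^+ _) => e; ring.
have out m : s (lshift q m) != s (rshift p j).
  by rewrite (inj_eq perm_inj) eq_lrshift.
rewrite !(update_comp w j _ rK) !(update_notin w _ out) b_lin.
by move: (_ ^+ _) => e; ring.
Qed.

End MultilinearForms.

Section ContactNondegenerate.
Variables (K : numFieldType) (g : lieAlgType K) (eta : 'Hom(g, K^o)).

(** A nonzero [z] in the kernel of [eta] and in the radical of [d eta] would kill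
    every factor of the top form, which would then vanish by
    [top_form_vanishes]. *)
Lemma contact_nondegenerate z : contact eta -> eta z = 0 ->
  (forall a, dform eta z a = 0) -> z = 0.
Proof.
move=> [n [dimg [w wn0]]] eta_z dz; apply/eqP; apply: contraNT wn0 => z0.
have dz' a : dform eta a z = 0.
  by rewrite -[0]oppr0 -(dz a) /dform bracketC raddfN opprK.
have lin2 : multilinear (dform2 eta).
  move=> {}w i c a b; rewrite /dform2 /update /dform.
  have [->|->] : i = ord0 \/ i = ord_max.
    by case: i => -[|[|//]] ?; [left|right]; apply: val_inj.
  - by rewrite /= bracketDZl linearP opprD -mulrN.
  - by rewrite /= bracketDZr linearP opprD -mulrN.
have dz2 : vanishes_at (dform2 eta) z.
  move=> {}w i wi; have [i0|i1] : i = ord0 \/ i = ord_max.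
    by case: i {wi} => -[|[|//]] ?; [left|right]; apply: val_inj.
  - by rewrite /dform2 -i0 wi dz.
  - by rewrite /dform2 -i1 wi dz'.
have pow k : multilinear (wedge_pow2 (dform2 eta) k) /\
             vanishes_at (wedge_pow2 (dform2 eta) k) z.
  elim: k => [|k [IH1 IH2]]; first by split=> [? []|? []].
  by split; [apply: wedge_multilinear|apply: wedge_vanishes_at].
have [powl powz] := pow n.
apply/eqP; apply: (@top_form_vanishes _ _ _ _ z) => //.
- by rewrite dimg; lia.
- apply: wedge_multilinear => // {}w i c a b.
  by rewrite /form1 /update (ord1 i) eqxx linearP.
- exact: wedge_alternating.
- by apply: wedge_vanishes_at => // {}w i; rewrite (ord1 i) /form1 => ->.
Qed.

End ContactNondegenerate.

(** What the classification uses of a contact form and of its Reeb vector. *)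
Lemma contact_reeb_data (K : numFieldType) (g : lieAlgType K)
    (eta : 'Hom(g, K^o)) xi :
  contact eta -> is_reeb eta xi ->
  exists e : {linear g -> K^o}, [/\ e xi = 1, forall a, e (bracket xi a) = 0 &
    forall z, e z = 0 -> (forall a, e (bracket z a) = 0) -> z = 0].
Proof.
move=> ct [xi1 dxi]; exists (fun_of_lfun eta : {linear _ -> _}); split=> // [a|z z0 dz].
  by apply/eqP; rewrite -oppr_eq0; apply/eqP/dxi.
apply: (contact_nondegenerate ct z0) => a; rewrite /dform.
by apply/eqP; rewrite oppr_eq0; apply/eqP/dz.
Qed.

(** * Structure constants *)

Section StructureConstants.
Variables (K : fieldType) (n : nat).
Implicit Types (sc : 'I_n -> 'M[K]_n) (a b c : 'rV[K]_n).

(** Structure constants are stored as matrices: row [j] of [sc i] is the bracket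
    of the basis vectors [i] and [j], so that [sc_ad sc a] is the matrix of
    [ad a] acting on row vectors from the right.  In this form they can be
    transported along a field extension entry by entry. *)
Definition sc_ad sc a : 'M[K]_n := \sum_i a 0 i *: sc i.

Definition sc_bracket sc a b : 'rV[K]_n := b *m sc_ad sc a.

Definition sc_lie sc : Prop :=
  (forall i j, row j (sc i) = - row i (sc j)) /\
  (forall i j, sc j *m sc i - sc i *m sc j = sc_ad sc (row j (sc i))).

Lemma sc_adD sc a b : sc_ad sc (a + b) = sc_ad sc a + sc_ad sc b.
Proof.
by rewrite /sc_ad -big_split; apply: eq_bigr => i _; rewrite mxE scalerDl.
Qed.

Lemma sc_adZ sc k a : sc_ad sc (k *: a) = k *: sc_ad sc a.
Proof.
by rewrite /sc_ad scaler_sumr; apply: eq_bigr => i _; rewrite mxE scalerA.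
Qed.

HB.instance Definition _ sc := GRing.isLinear.Build K 'rV[K]_n 'M[K]_n *:%R
  (sc_ad sc) (fun k a b => etrans (sc_adD sc (k *: a) b)
                              (congr1 (fun M => M + _) (sc_adZ sc k a))).

Lemma sc_bracketC sc a b : sc_lie sc -> sc_bracket sc a b = - sc_bracket sc b a.
Proof.
case=> skew _; rewrite /sc_bracket /sc_ad !mulmx_sumr.
rewrite [a in RHS]row_sum_delta [b in LHS]row_sum_delta.
under eq_bigr do rewrite mulmx_suml.
under [in RHS]eq_bigr do rewrite mulmx_suml.
rewrite exchange_big -sumrN; apply: eq_bigr => i _; rewrite -sumrN.
apply: eq_bigr => j _.
by rewrite -!scalemxAl -!scalemxAr -!rowE skew !scalerN !scalerA mulrC.
Qed.

Lemma sc_jacobi sc a b c : sc_lie sc ->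
  sc_bracket sc (sc_bracket sc a b) c =
  sc_bracket sc a (sc_bracket sc b c) - sc_bracket sc b (sc_bracket sc a c).
Proof.
case=> _ jac; rewrite /sc_bracket -!mulmxA -mulmxBr; congr (c *m _).
have adl d M : sc_ad sc d *m M = \sum_i d 0 i *: (sc i *m M).
  by rewrite mulmx_suml; apply: eq_bigr => i _; rewrite scalemxAl.
have adr d M : M *m sc_ad sc d = \sum_i d 0 i *: (M *m sc i).
  by rewrite mulmx_sumr; apply: eq_bigr => i _; rewrite scalemxAr.
rewrite (adr _ a b) linear_sum (adl _ a) (adr _ a (sc_ad sc b)) -sumrB /=.
apply: eq_bigr => i _.
rewrite linearZ -scalerBr /=; congr (_ *: _).
rewrite {1}[b]row_sum_delta mulmx_suml linear_sum (adl _ b) (adr _ b) -sumrB /=.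
apply: eq_bigr => j _; rewrite -scalemxAl linearZ -scalerBr /=; congr (_ *: _).
by rewrite -rowE -jac.
Qed.

End StructureConstants.

(** * Generalized eigenspaces *)

Section GeneralizedEigenspaces.
Variables (F : fieldType) (n' : nat).
Let n := n'.+1.
Implicit Types (T : 'M[F]_n) (a : F) (v : 'rV[F]_n).

(** The exponent may exceed the dimension: the characteristic polynomial is
    [('X - a)^m] times a factor prime to every power of ['X - a], with [m] at
    most the dimension, and a Bezout relation lowers the exponent to [m]. *)
Lemma geigenspaceP T a v :
  reflect (exists k, v *m (T - a%:M) ^+ k = 0) (v <= geigenspace T a)%MS.
Proof.
apply: (iffP idP) => [|[k vk]].
  by rewrite geigenspaceE => /sub_kermxP ?; exists n.
have [m [q qa pE]] := multiplicity_XsubC (char_poly T) a.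
rewrite (monic_neq0 (char_poly_monic T)) /= in qa.
have hX (l : nat) : horner_mx T (('X - a%:P) ^+ l) = (T - a%:M) ^+ l.
  by rewrite rmorphXn /= rmorphB /= horner_mx_X horner_mx_C.
have le_mn : (m <= n)%N.
  have q0 : q != 0 by apply: contraNneq qa => ->; rewrite root0.
  have := size_char_poly T; rewrite pE size_Mmonic ?monic_exp ?monicXsubC //.
  rewrite size_exp_XsubC addnS /= => szE.
  rewrite -ltnS -szE; move: q0; rewrite -size_poly_gt0.
  by case: size => // s _; rewrite addSn ltnS leq_addl.
have /Bezout_eq1_coprimepP [[c d] /= cd1] : coprimep q (('X - a%:P) ^+ k).
  by rewrite coprimep_expr // coprimep_XsubC.
have vm : v *m (T - a%:M) ^+ m = 0.
  rewrite -hX -[('X - _) ^+ m]mul1r -cd1 mulrDl mulrAC [d * _]mulrC -!mulrA.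
  rewrite [_ ^+ m * q]mulrC -pE rmorphD !rmorphM /= Cayley_Hamilton.
  by rewrite mulr0 add0r hX mulmxA vk mul0mx.
rewrite geigenspaceE; apply/sub_kermxP.
have -> : (T - a%:M) ^+ n = (T - a%:M) ^+ m *m (T - a%:M) ^+ (n - m).
  by rewrite mulmxE -exprD subnKC.
by rewrite mulmxA vm mul0mx.
Qed.

Lemma rank_geigenspaces T (s : seq F) : uniq s ->
  (\sum_(a <- s) \rank (geigenspace T a) <= n)%N.
Proof.
move=> us; rewrite (big_nth 0) big_mkord.
have /mxdirectP <- : mxdirect (\sum_(i < size s) geigenspace T s`_i).
  apply: mxdirect_sum_geigenspace => i j _ _ sij; apply: val_inj.
  by apply: (elimT (uniqP 0) us) sij; rewrite inE.
exact: rank_leq_col.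
Qed.

End GeneralizedEigenspaces.

(** The characteristic polynomial splits and divides the product of the
    [('X - a)^dim] over its distinct roots, so that the kernel of this product
    is the whole space. *)
Lemma geigenspace_decomposition (F : closedFieldType) n' (T : 'M[F]_n'.+1)
    (v : 'rV[F]_n'.+1) :
  exists s : seq F, exists w : F -> 'rV[F]_n'.+1,
    (forall a, (w a <= geigenspace T a)%MS) /\ v = \sum_(a <- s) w a.
Proof.
have [r rE] := closed_field_poly_normal (char_poly T).
move: rE; rewrite (monicP (char_poly_monic T)) scale1r => rE.
pose s := undup r; exists s.
have sp : char_poly T %| \prod_(i < size s) ('X - (s`_i)%:P) ^+ n'.+1.
  have szr : (size r <= n'.+1)%N.
    by have := size_char_poly T; rewrite rE size_prod_XsubC => -[->].
  rewrite -(big_mkord xpredT (fun i => ('X - (s`_i)%:P) ^+ n'.+1)).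
  rewrite -(big_nth 0 xpredT (fun a => ('X - a%:P) ^+ n'.+1)) rE.
  rewrite -(big_undup_iterop_count _ r).
  apply: (big_ind2 (fun p q => p %| q)) => [|*|a _]; first exact: dvdpp.
    exact: dvdp_mul.
  rewrite Monoid.iteropE iter_mulr_1 dvdp_exp2l //.
  exact: leq_trans (count_size _ _) szr.
have us : uniq s by exact: undup_uniq.
have cop : {in predT &, forall i j : 'I_(size s), j != i ->
    coprimep (('X - (s`_i)%:P) ^+ n'.+1) (('X - (s`_j)%:P) ^+ n'.+1)}.
  move=> i j _ _ Nij; rewrite coprimep_expr ?coprimep_expl //.
  by rewrite coprimep_XsubC root_XsubC nth_uniq.
have /sub_sumsmxP [u ->] :
  (v <= \sum_(i < size s) kermxpoly T (('X - (s`_i)%:P) ^+ n'.+1))%MS.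
  rewrite -(kermxpoly_prod T cop).
  by rewrite (kermxpoly_min (dvdp_trans (mxminpoly_dvd_char T) sp)) submx1.
exists (fun a => if (insub (index a s) : option 'I_(size s)) is Some i then
   if s`_i == a then u i *m geigenspace T s`_i else 0 else 0); split=> [a|].
  case: insubP => [i _ _|_]; last exact: sub0mx.
  by case: eqP => [<-|_]; rewrite ?sub0mx ?submxMl.
rewrite [RHS](big_nth 0) big_mkord; apply: eq_bigr => i _.
by rewrite index_uniq // valK eqxx.
Qed.

(** * A one-dimensional Reeb kernel over an algebraically closed field *)

Section NoRegularReeb.
Variables (F : numClosedFieldType) (sc : 'I_5 -> 'M[F]_5).
Variables (xi : 'rV[F]_5) (eta : {linear 'rV[F]_5 -> F^o}).
Hypothesis lie_sc : sc_lie sc.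

Let T := sc_ad sc xi.
Local Notation br := (sc_bracket sc).
Local Notation G a := (geigenspace T a).

Hypothesis eta_xi : eta xi = 1.
Hypothesis eta_T : forall a, eta (a *m T) = 0.
Hypothesis ker_T : forall a, a *m T = 0 -> a = eta a *: xi.
Hypothesis nondeg : forall a, a != 0 -> eta a = 0 -> exists b, eta (br a b) != 0.

Let brE a b : br a b = b *m sc_ad sc a. Proof. by []. Qed.

Let brBl a b c : br (a - b) c = br a c - br b c.
Proof. by rewrite /sc_bracket linearB /= mulmxBr. Qed.

Let brZl k a b : br (k *: a) b = k *: br a b.
Proof. by rewrite /sc_bracket linearZ /= scalemxAr. Qed.

Let brBr a b c : br a (b - c) = br a b - br a c.
Proof. exact: mulmxBl. Qed.

Let brZr k a b : br a (k *: b) = k *: br a b.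
Proof. by rewrite /sc_bracket scalemxAl. Qed.

Let br0l b : br 0 b = 0.
Proof. by rewrite /sc_bracket linear0 mulmx0. Qed.

Let br0r a : br a 0 = 0.
Proof. exact: mul0mx. Qed.

Let brr a : br a a = 0.
Proof.
have /eqP := sc_bracketC a a lie_sc.
by rewrite -subr_eq0 opprK -mulr2n -scaler_nat scaler_eq0 pnatr_eq0 => /eqP.
Qed.

Let xi_neq0 : xi != 0.
Proof.
apply/eqP => x0; have := eta_xi; rewrite x0 linear0 => /eqP.
by rewrite eq_sym oner_eq0.
Qed.

Let xiT : xi *m T = 0. Proof. exact: brr. Qed.

Let brT a b : br a b *m T = br (a *m T) b + br a (b *m T).
Proof. by rewrite /T -!brE (sc_jacobi _ _ _ lie_sc) subrK. Qed.

(** [T] is a derivation, so [T - (a + b)] acts on a bracket as [T - a] on the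
    first factor plus [T - b] on the second. *)
Let br_weight a b u v : (u <= G a)%MS -> (v <= G b)%MS -> (br u v <= G (a + b))%MS.
Proof.
move=> /geigenspaceP [k uk] /geigenspaceP [l vl].
have [m le_m] := ubnP (k + l); apply/geigenspaceP.
exists m; elim: m => // m IHm in k l u v uk vl le_m *.
have step w c j : w *m (T - c%:M) ^+ j.+1 = 0 ->
    (w *m (T - c%:M)) *m (T - c%:M) ^+ j = 0.
  by rewrite exprS mulmxA.
have -> : br u v *m (T - (a + b)%:M) ^+ m.+1 =
    br (u *m (T - a%:M)) v *m (T - (a + b)%:M) ^+ m
    + br u (v *m (T - b%:M)) *m (T - (a + b)%:M) ^+ m.
  rewrite exprS mulmxA -mulmxDl; congr (_ *m _).
  rewrite !mulmxBr brT !mul_mx_scalar brBl brZl brBr brZr scalerDl.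
  by rewrite opprD addrACA.
case: k l uk vl le_m => [|k] [|l] uk vl le_m.
- by rewrite -[u]mulmx1 uk !(mulmx0, mul0mx, br0l) addr0.
- by rewrite -[u]mulmx1 uk !(mulmx0, mul0mx, br0l) addr0.
- by rewrite -[v]mulmx1 vl !(mulmx0, mul0mx, br0r) addr0.
- have h1 : (k + l.+1 < m)%N by [].
  have h2 : (k.+1 + l < m)%N by rewrite addSnnS.
  rewrite (IHm _ _ _ _ (step _ _ _ _ uk) vl h1).
  by rewrite (IHm _ _ _ _ uk (step _ _ _ _ vl) h2) addr0.
Qed.

(** As [eta] vanishes on the image of [T], applying [T - a] to [v] multiplies
    [eta v] by [- a]. *)
Let eta_weight a v : a != 0 -> (v <= G a)%MS -> eta v = 0.
Proof.
move=> a0 /geigenspaceP [k]; elim: k => [|k IHk] in v *.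
  by rewrite mulmx1 => ->; rewrite linear0.
rewrite exprS mulmxA => /IHk; rewrite mulmxBr mul_mx_scalar linearB linearZ /=.
rewrite eta_T sub0r => /eqP; rewrite oppr_eq0 mulf_eq0 (negPf a0) /=.
by move=> /eqP.
Qed.

Let weight0 v : (v <= G 0)%MS -> v = eta v *: xi.
Proof.
move=> /geigenspaceP [k]; rewrite raddf0 subr0.
elim: k => [|k IHk] in v *; first by rewrite mulmx1 => ->; rewrite linear0 scale0r.
by rewrite exprS mulmxA => /IHk; rewrite eta_T scale0r; apply: ker_T.
Qed.

Let inj_T v : eta v = 0 -> v *m T = 0 -> v = 0.
Proof. by move=> v0 /ker_T; rewrite v0 scale0r. Qed.

(** Nondegeneracy gives some [b] with [eta (br e b)] nonzero, and only its
    component of weight [- a] can contribute to this value. *)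
Let partner a e : a != 0 -> e != 0 -> (e <= G a)%MS ->
  exists2 f, (f <= G (- a))%MS & br e f = xi.
Proof.
move=> a0 e0 ea; have e_eta := eta_weight a0 ea.
have [f fa ef] : exists2 f, (f <= G (- a))%MS & eta (br e f) != 0.
  have [b] := nondeg e0 e_eta.
  have [s [w [Gw ->]]] := geigenspace_decomposition T b.
  have [ea0|ea0] := eqVneq (eta (br e (w (- a)))) 0; last by exists (w (- a)).
  rewrite brE mulmx_suml linear_sum /= big1 ?eqxx // => c _.
  have [->//|ca] := eqVneq c (- a); rewrite -brE.
  by apply: (@eta_weight (a + c)); rewrite ?br_weight // addrC addr_eq0.
have := br_weight ea fa; rewrite subrr => /weight0.
move: (eta _) ef => t t0 efE; exists (t^-1 *: f); first exact: scalemx_sub.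
by rewrite brZr efE scalerA mulVf ?scale1r.
Qed.

Let weight a := geigenspace T a != 0.

Let weightP a (v : 'rV_5) : (v <= G a)%MS -> v != 0 -> weight a.
Proof. by move=> va; apply: contra_neq => a0; move: va; rewrite a0 submx0 => /eqP. Qed.

Let weight_count (s : seq F) : uniq s -> all weight s -> (size s <= 5)%N.
Proof.
move=> us ws; apply: leq_trans (rank_geigenspaces T us).
rewrite -sum1_size big_seq [leqRHS]big_seq; apply: leq_sum => a /(allP ws).
by rewrite lt0n mxrank_eq0.
Qed.

Let weight_opp a : weight a -> weight (- a).
Proof.
have [->|a0] := eqVneq a 0; first by rewrite oppr0.
move=> /rowV0Pn [e ea e0]; have [f fa ef] := partner a0 e0 ea.
apply: weightP fa _; apply: contraNneq xi_neq0 => f0.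
by rewrite -ef f0 br0r.
Qed.

Let weights_exhaust (s : seq F) : (forall b, weight b -> b \in s) ->
  (5 <= \sum_(a <- s) \rank (G a))%N.
Proof.
move=> ws; have : (\rank (\sum_(a <- s) G a)%MS <= \sum_(a <- s) \rank (G a))%N.
  elim: s {ws} => [|a s IHs]; first by rewrite !big_nil mxrank0.
  rewrite !big_cons; apply: leq_trans (leq_add (leqnn _) IHs).
  by case: (mxrank_adds_leqif (G a) (\sum_(b <- s) G b)%MS).
apply: leq_trans; rewrite -{1}(mxrank1 F 5); apply/mxrankS/row_subP => i.
have [r [w [Gw ->]]] := geigenspace_decomposition T (row i 1%:M).
apply: summx_sub => a _; have [->|wa] := eqVneq (w a) 0; first exact: sub0mx.
apply: submx_trans (Gw a) _; have {}/ws sa := weightP (Gw a) wa.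
by rewrite (big_rem a) //=; apply: addsmxSl.
Qed.

Let rank_weight0 : \rank (G 0) = 1%N.
Proof.
apply/eqP; rewrite eqn_leq; apply/andP; split.
  apply: leq_trans (rank_leq_row xi); apply/mxrankS/row_subP => i.
  by rewrite (weight0 (row_sub i _)) scalemx_sub.
rewrite lt0n mxrank_eq0; apply: (@weightP 0 xi).
  by apply/geigenspaceP; exists 1%N; rewrite raddf0 subr0 expr1.
exact: xi_neq0.
Qed.

(** Here [G a] is abelian.  For [u] in it, [br u f] is [t *: xi] for some [t],
    and the Jacobi identity for [e], [u], [f] says that [T] kills [u - t *: e]. *)
Let simple_weight a e f u : a != 0 -> ~~ weight (2%:R * a) ->
  (e <= G a)%MS -> (f <= G (- a))%MS -> br e f = xi -> (u <= G a)%MS ->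
  exists t, u = t *: e.
Proof.
move=> a0 w2a ea fa ef ua.
have eu : br e u = 0.
  apply: contraNeq w2a; apply: weightP.
  by rewrite (_ : 2%:R * a = a + a) ?br_weight // mulr_natl.
have [t tE] : exists t, br u f = t *: xi.
  by exists (eta (br u f)); apply: weight0; rewrite -(subrr a) br_weight.
exists t; apply/eqP; rewrite -subr_eq0; apply/eqP/inj_T.
  by rewrite linearB linearZ /= (eta_weight a0 ua) (eta_weight a0 ea) scaler0 subr0.
have := sc_jacobi e u f lie_sc; rewrite eu br0l tE ef brZr.
rewrite (sc_bracketC e xi) // (sc_bracketC u xi) // mulmxBl -scalemxAl.
rewrite opprK scalerN => /esym /(canRL (addrK _)).
by rewrite sub0r => ->; rewrite subrr.
Qed.

(** [simple_weight] makes [G a] and [G (- a)] lines.  The dimension then leaves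
    room for exactly one other pair of weights b, - b, and these are simple. *)
Let no_maximal_weight a : a != 0 -> weight a -> ~~ weight (2%:R * a) -> False.
Proof.
move=> a0 wa w2a; have w2a' : ~~ weight (- (2%:R * a)).
  by apply: contra w2a => /weight_opp; rewrite opprK.
have na0 : - a != 0 by rewrite oppr_eq0.
have [/rowV0Pn [e ea e0]] := wa; have [f fa ef] := partner a0 e0 ea.
have lin n (x y z : F) : y = z -> n.+1%:R * x = y - z -> x = 0.
  by move=> ->; rewrite subrr => /eqP; rewrite mulf_eq0 pnatr_eq0 => /eqP.
have eqby (x x' y z : F) : y = z -> x - x' = y - z -> x = x'.
  by move=> ->; rewrite subrr => /eqP; rewrite subr_eq0 => /eqP.
have aNa : a != - a.
  by rewrite -addr_eq0 -mulr2n -mulr_natl mulf_eq0 pnatr_eq0.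
have rk1 c (h : 'rV_5) : (forall x, (x <= G c)%MS -> exists t, x = t *: h) ->
    (\rank (G c) <= 1)%N.
  move=> hc; apply: leq_trans (rank_leq_row h); apply/mxrankS/row_subP => i.
  by have [t ->] := hc _ (row_sub i _); rewrite scalemx_sub.
have rka : (\rank (G a) <= 1)%N by apply: (rk1 a e) => x; apply: simple_weight ef.
have rkNa : (\rank (G (- a)) <= 1)%N.
  apply: (rk1 _ (- f)) => x; apply: (@simple_weight (- a) (- f) e) => //.
  - by rewrite mulrN.
  - by rewrite -scaleN1r scalemx_sub.
  - by rewrite opprK.
  - by rewrite sc_bracketC // /sc_bracket mulNmx opprK.
have := @weights_exhaust [:: 0; a; - a].
rewrite !big_cons big_nil rank_weight0 => /(_ _) exh.
(* A further weight b exists, as 0, a and - a account for three dimensions.   *)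
suff /exh : forall b, weight b -> b \in [:: 0; a; - a].
  by case: (\rank _) rka => [|[|//]] _; case: (\rank _) rkNa => [|[|//]].
move=> b wb; apply: contraT => bs; exfalso.
move: bs; rewrite !inE !negb_or => /and3P [b0 ba bNa].
have [/rowV0Pn [u ub u0]] := wb; have [u' ub' uu'] := partner b0 u0 ub.
have wNb := weight_opp wb; have wNa := weight_opp wa.
have w0 : weight 0 by rewrite /weight -mxrank_eq0 rank_weight0.
have us : uniq [:: 0; a; - a; b; - b].
  have Nab : - a != b by rewrite eq_sym.
  have aNb : a != - b by rewrite -eqr_oppLR.
  have bNb : b != - b by rewrite -addr_eq0 -mulr2n -mulr_natl mulf_eq0 pnatr_eq0.
  rewrite /= !inE !negb_or ![0 == _]eq_sym !oppr_eq0 eqr_opp [a == b]eq_sym.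
  by rewrite a0 b0 aNa ba Nab aNb bNb.
have [rkb rkNb] : (\rank (G b) <= 1)%N /\ (\rank (G (- b)) <= 1)%N.
  have sum5 (p q r s t : nat) : (0 < p)%N -> (0 < q)%N -> (0 < r)%N ->
      (0 < s)%N -> (0 < t)%N -> (p + (q + (r + (s + (t + 0)))) <= 5)%N ->
    (s <= 1)%N /\ (t <= 1)%N by clear; lia.
  have := rank_geigenspaces T us; rewrite !big_cons big_nil.
  move: w0 wa wNa wb wNb; rewrite /weight -!mxrank_eq0 -!lt0n.
  exact: sum5.
have only c : c \notin [:: 0; a; - a; b; - b] -> ~~ weight c.
  move=> cs; apply/negP => wc.
  have := @weight_count (c :: [:: 0; a; - a; b; - b]).
  by rewrite cons_uniq cs us [all _ _]/= wc w0 wa wNa wb wNb => /(_ isT isT).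
have line c (x y : 'rV_5) : (\rank (G c) <= 1)%N -> x != 0 ->
    (x <= G c)%MS -> (y <= G c)%MS -> br x y = 0.
  move=> rk x0 xc yc; have : (G c <= x)%MS.
    rewrite -(mxrank_leqif_sup xc).2 rank_rV x0 eqn_leq rk andbT lt0n mxrank_eq0.
    exact: weightP xc x0.
  by move/(submx_trans yc)/sub_rVP => [t ->]; rewrite brZr brr scaler0.
have outside c (x : 'rV_5) : c \notin [:: 0; a; - a; b; - b] -> (x <= G c)%MS -> x = 0.
  move=> /only wc xc; apply/eqP/contraT => x0.
  by rewrite (weightP xc x0) in wc.
have Tu : u *m T != 0 by apply: contra_neq u0; apply: inj_T; apply: eta_weight ub.
have Te : e *m T != 0 by apply: contra_neq e0; apply: inj_T; apply: eta_weight ea.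
have u'0 : u' != 0 by apply: contraNneq xi_neq0 => h; rewrite -uu' h br0r.
(* As T u <> 0, the first identity makes a difference or a sum of a and b a    *)
(* weight, which forces a = 2 b or a = - 2 b; the second then yields T e = 0.  *)
have efu : u *m T = br e (br f u) - br f (br e u).
  by rewrite -(sc_jacobi e f u lie_sc) ef.
have uu'e : e *m T = br u (br u' e) - br u' (br u e).
  by rewrite -(sc_jacobi u u' e lie_sc) uu'.
have eu := br_weight ea ub; have fu := br_weight fa ub.
have ue := br_weight ub ea; have u'e := br_weight ub' ea.
have inside c (x : 'rV_5) : (x <= G c)%MS -> x != 0 ->
    [\/ c = 0, c = a, c = - a | c = b \/ c = - b].
  move=> xc x0; have : c \in [:: 0; a; - a; b; - b].
    by apply: contraNT x0 => /outside /(_ xc) ->.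
  rewrite !inE => /or4P [/eqP|/eqP|/eqP|/orP[]/eqP] ->;
    by [apply: Or41|apply: Or42|apply: Or43|apply: Or44; auto].
have [fu0|fu0] := eqVneq (br f u) 0; last first.
  have ab : a = 2%:R * b.
    case: (inside _ _ fu fu0) => [h|h|h|[h|h]].
    - by case/eqP: ba; apply: (eqby _ _ _ _ h); ring.
    - case/negP: w2a; rewrite (_ : _ * a = b) //.
      by apply: (eqby _ _ _ _ (esym h)); ring.
    - by case/eqP: b0; apply: (lin 0%N _ _ _ h); ring.
    - by case/eqP: a0; apply: (lin 0%N _ _ _ (esym h)); ring.
    - by apply: (eqby _ _ _ _ (esym h)); ring.
  have ue0 : br u e = 0.
    apply/eqP/contraT => ue0; case/eqP: b0.
    case: (inside _ _ ue ue0) => [h|h|h|[h|h]].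
    - by apply: (lin 2%N _ _ _ h); rewrite ab; ring.
    - by apply: (lin 0%N _ _ _ h); rewrite ab; ring.
    - by apply: (lin 4%N _ _ _ h); rewrite ab; ring.
    - by apply: (lin 1%N _ _ _ h); rewrite ab; ring.
    - by apply: (lin 3%N _ _ _ h); rewrite ab; ring.
  rewrite ab (_ : - b + _ = b) in u'e; last by ring.
  by move: Te; rewrite uu'e ue0 br0r subr0 (line b) ?eqxx.
have [eu0|eu0] := eqVneq (br e u) 0.
  by move: Tu; rewrite efu fu0 eu0 !br0r subr0 eqxx.
have ab : a = - (2%:R * b).
  case: (inside _ _ eu eu0) => [h|h|h|[h|h]].
  - by case/eqP: bNa; apply: (eqby _ _ _ _ h); ring.
  - by case/eqP: b0; apply: (lin 0%N _ _ _ h); ring.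
  - case/negP: w2a'; rewrite (_ : - (_ * a) = b) //.
    by apply: (eqby _ _ _ _ (esym h)); ring.
  - by case/eqP: a0; apply: (lin 0%N _ _ _ h); ring.
  - by apply: (eqby _ _ _ _ h); ring.
have u'e0 : br u' e = 0.
  apply/eqP/contraT => u'e0; case/eqP: b0.
  case: (inside _ _ u'e u'e0) => [h|h|h|[h|h]].
  - by apply: (lin 2%N _ _ _ (esym h)); rewrite ab; ring.
  - by apply: (lin 0%N _ _ _ (esym h)); rewrite ab; ring.
  - by apply: (lin 4%N _ _ _ (esym h)); rewrite ab; ring.
  - by apply: (lin 3%N _ _ _ (esym h)); rewrite ab; ring.
  - by apply: (lin 1%N _ _ _ (esym h)); rewrite ab; ring.
rewrite ab (_ : b + _ = - b) in ue; last by ring.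
by move: Te; rewrite uu'e u'e0 br0r sub0r oppr_eq0 (line (- b)) ?eqxx.
Qed.

(** By [no_maximal_weight] the weights are stable under doubling, so a nonzero
    weight a would give six weights a, 2 a, 4 a, 8 a, 16 a, 32 a in dimension
    five; but without nonzero weights the dimension would be one. *)
Lemma no_regular_reeb : False.
Proof.
have dbl a : a != 0 -> weight a -> weight (2%:R * a).
  by move=> a0 wa; apply: contraT => /(no_maximal_weight a0 wa).
have := @weights_exhaust [:: 0]; rewrite big_seq1 rank_weight0 => /(_ _) exh.
suff /exh : forall b, weight b -> b \in [:: 0] by [].
move=> a wa; rewrite inE; apply: contraT => a0; exfalso.
have us : uniq (mkseq (fun i => (2 ^ i)%:R * a) 6).
  by apply: mkseq_uniq => i j /(mulIf a0) /eqP; rewrite eqr_nat eqn_exp2l // => /eqP.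
have := weight_count us; rewrite size_mkseq => /(_ _) six.
suff /six : all weight (mkseq (fun i => (2 ^ i)%:R * a) 6) by [].
apply/allP => _ /mapP [k _ ->]; elim: k => [|k IHk]; first by rewrite mul1r.
by rewrite expnS natrM -mulrA dbl // mulf_neq0 // pnatr_eq0 expn_eq0.
Qed.

End NoRegularReeb.

(** * Extension of scalars to the complex numbers *)

Section ScalarExtension.
Variables (K L : fieldType) (f : {rmorphism K -> L}) (n : nat).
Implicit Types sc : 'I_n -> 'M[K]_n.

Lemma map_sc_ad sc a :
  map_mx f (sc_ad sc a) = sc_ad (fun i => map_mx f (sc i)) (map_mx f a).
Proof.
by rewrite /sc_ad raddf_sum; apply: eq_bigr => i _ /=; rewrite map_mxZ mxE.
Qed.

Lemma map_sc_lie sc : sc_lie sc -> sc_lie (fun i => map_mx f (sc i)).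
Proof.
move=> [skew jac]; split=> i j; first by rewrite -!map_row skew map_mxN.
by rewrite -!map_mxM -map_mxB -map_row -map_sc_ad jac.
Qed.

End ScalarExtension.

Lemma unitmx_inj (K : fieldType) n (M : 'M[K]_n) :
  (forall v : 'rV_n, v *m M = 0 -> v = 0) -> M \in unitmx.
Proof.
move=> Minj; rewrite -row_free_unit -kermx_eq0; apply/rowV0P => v.
by move/sub_kermxP/Minj.
Qed.

Section Coordinates.
Variables (K : fieldType) (g : lieAlgType K) (n : nat) (X : n.-tuple g).
Hypothesis Xb : basis_of fullv X.

Definition coords (a : g) : 'rV[K]_n := \row_i coord X i a.

Lemma coords_is_linear : linear coords.
Proof. by move=> c a b; apply/rowP => i; rewrite !mxE linearP. Qed.

HB.instance Definition _ := GRing.isLinear.Build K g 'rV[K]_n *:%R coords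
  coords_is_linear.

Definition structure_constants (i : 'I_n) : 'M[K]_n :=
  \matrix_j coords (bracket X`_i X`_j).

Let decomp a : a = \sum_i coord X i a *: X`_i.
Proof. by rewrite -(coord_basis Xb (memvf a)). Qed.

Lemma coords_inj : injective coords.
Proof.
move=> a b /rowP ab; rewrite (decomp a) (decomp b).
by apply: eq_bigr => i _; have := ab i; rewrite !mxE => ->.
Qed.

Lemma coords_surj v : exists a, coords a = v.
Proof.
exists (\sum_i v 0 i *: X`_i); apply/rowP => i; rewrite mxE.
by rewrite coord_sum_free // (basis_free Xb).
Qed.

Lemma coords_basis (i : 'I_n) : coords X`_i = delta_mx 0 i.
Proof.
apply/rowP => j; rewrite !mxE coord_free ?(basis_free Xb) // eqxx /=.
by rewrite (eqtype.eq_sym i).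
Qed.

Lemma coords_bracket a b :
  sc_bracket structure_constants (coords a) (coords b) = coords (bracket a b).
Proof.
have brl c : bracket (\sum_i coord X i a *: X`_i) c =
             \sum_i coord X i a *: bracket X`_i c.
  elim/big_rec2: _ => [|i x y _ IH]; first exact: bracket0l.
  by rewrite bracketDZl IH.
rewrite [in RHS](decomp a) brl linear_sum /sc_bracket /sc_ad mulmx_sumr.
apply: eq_bigr => i _; rewrite mxE -scalemxAr linearZ /=; congr (_ *: _).
rewrite [in RHS](decomp b) linear_sum linear_sum /= [LHS]mulmx_sum_row.
by apply: eq_bigr => j _; rewrite rowK mxE !linearZ.
Qed.

Lemma structure_constants_lie : sc_lie structure_constants.
Proof.
have adE a : sc_ad structure_constants (coords a) =
    \matrix_j coords (bracket a X`_j).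
  apply/row_matrixP => j; rewrite rowK rowE -coords_basis.
  exact: coords_bracket.
have scE i : structure_constants i = sc_ad structure_constants (coords X`_i).
  by rewrite adE.
have scM a b := coords_bracket a b; rewrite /sc_bracket in scM.
split=> i j; first by rewrite !rowK bracketC linearN.
rewrite rowK adE; apply/row_matrixP => l; rewrite linearB /= !row_mul !rowK.
by rewrite !scE !scM -linearB bracket_ad.
Qed.

End Coordinates.

Section DualVector.
Variables (K : fieldType) (n : nat) (h : 'cV[K]_n).

Definition covector_eval (a : 'rV[K]_n) : K^o := (a *m h) 0 0.

Lemma covector_eval_is_linear : linear covector_eval.
Proof. by move=> c a b; rewrite /covector_eval mulmxDl -scalemxAl !mxE. Qed.

HB.instance Definition _ := GRing.isLinear.Build K 'rV[K]_n K^o *:%R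
  covector_eval covector_eval_is_linear.

(** The Gram matrix of [eta [a, b] + eta a * eta b].  In odd dimension this bilinear
    form is nondegenerate exactly when the contact condition holds, which thus
    becomes the invertibility of a matrix and survives a field extension. *)
Definition contact_gram (sc : 'I_n -> 'M[K]_n) : 'M[K]_n :=
  (\matrix_i (sc i *m h)^T) + h *m h^T.

Lemma contact_gramE sc a b :
  (a *m contact_gram sc *m b^T) 0 0 =
  covector_eval (sc_bracket sc a b) + covector_eval a * covector_eval b.
Proof.
have -> : a *m contact_gram sc *m b^T =
    (sc_bracket sc a b *m h)^T + (a *m h) *m (b *m h)^T.
  have adh : a *m \matrix_i (sc i *m h)^T = (sc_ad sc a *m h)^T.
    rewrite /sc_ad mulmx_suml mulmx_sum_row raddf_sum; apply: eq_bigr => i _ /=.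
    by rewrite rowK -scalemxAl linearZ.
  by rewrite mulmxDr mulmxDl adh -trmx_mul [(b *m h)^T]trmx_mul !mulmxA.
rewrite /covector_eval mxE mxE [X in _ + X = _]mxE big_ord1.
by rewrite [(b *m h)^T _ _]mxE.
Qed.

End DualVector.

Section ReebKernel.
Variables (R : rcfType) (g : lieAlgType R) (eta : {linear g -> R^o}) (xi : g).
Hypothesis dimg : \dim {:g} = 5%N.
Hypothesis eta_xi : eta xi = 1.
Hypothesis eta_br : forall a, eta (bracket xi a) = 0.
Hypothesis nondeg :
  forall z, eta z = 0 -> (forall a, eta (bracket z a) = 0) -> z = 0.

(** The hypotheses of [no_regular_reeb] amount to polynomial identities between
    structure constants and to the invertibility of two matrices: the Gram
    matrix above, and the matrix [S] of the map sending a to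
    [bracket xi a + eta a *: xi], which is injective when the kernel of [ad xi]
    is spanned by [xi].  All of this passes to the complex numbers. *)
Lemma reeb_kernel_not_line : ~ (forall a, bracket xi a = 0 -> a = eta a *: xi).
Proof.
move=> ker_xi.
have [X Xb] : exists X : 5.-tuple g, basis_of fullv X.
  by rewrite -dimg; exists (vbasis fullv); apply: vbasisP.
pose sc := structure_constants X; pose cr := coords X.
pose h : 'cV[R]_5 := \col_i eta X`_i.
have crh a : cr a *m h = (eta a)%:M.
  rewrite [in RHS](coord_basis Xb (memvf a)) linear_sum.
  apply/matrixP => i j; rewrite !ord1 !mxE eqxx mulr1n.
  by apply: eq_bigr => l _; rewrite !mxE linearZ.
pose T := sc_ad sc (cr xi).
have crT a : cr a *m T = cr (bracket xi a) by exact: coords_bracket.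
pose S := T + h *m cr xi.
have Su : S \in unitmx.
  apply: unitmx_inj => v; have [a <-] := coords_surj Xb v.
  rewrite mulmxDr mulmxA crh crT mul_scalar_mx -linearZ -linearD.
  rewrite -[0](linear0 (coords X)) => /(coords_inj Xb) a0.
  have eta_a : eta a = 0.
    have : eta (bracket xi a + eta a *: xi) = 0 by rewrite a0 linear0.
    rewrite raddfD /= linearZ /= eta_br eta_xi add0r => <-.
    by rewrite [RHS]mulr1.
  move: a0; rewrite eta_a scale0r addr0 => /ker_xi.
  by rewrite eta_a scale0r => ->; rewrite !linear0.
pose Q := contact_gram h sc.
have hE a : covector_eval h (cr a) = eta a.
  by rewrite /covector_eval crh mxE eqxx mulr1n.
have crQ a b : (cr a *m Q *m (cr b)^T) 0 0 = eta (bracket a b) + eta a * eta b.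
  by rewrite contact_gramE /cr coords_bracket // !hE.
have Qu : Q \in unitmx.
  apply: unitmx_inj => v; have [a <-] := coords_surj Xb v => aQ.
  have aQ' b : eta (bracket a b) + eta a * eta b = 0.
    by rewrite -crQ aQ mul0mx mxE.
  have eta_a : eta a = 0.
    have := aQ' xi; rewrite bracketC linearN eta_br eta_xi oppr0 add0r => <-.
    by rewrite mulr1.
  rewrite (nondeg eta_a) ?linear0 // => b.
  by have := aQ' b; rewrite eta_a mul0r addr0.
pose toC := real_complex R.
pose scC i := map_mx toC (sc i); pose xiC := map_mx toC (cr xi).
pose hC := map_mx toC h.
have TC : sc_ad scC xiC = map_mx toC T by rewrite map_sc_ad.
apply: (@no_regular_reeb _ scC xiC (covector_eval hC)).
- exact/map_sc_lie/structure_constants_lie.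
- by rewrite /= /covector_eval -map_mxM crh eta_xi !mxE /= rmorph1.
- move=> a; have Th : T *m h = 0.
    apply/row_matrixP => i; rewrite row0 rowE mulmxA -(coords_basis Xb) crT crh.
    by rewrite eta_br raddf0.
  by rewrite /= /covector_eval TC -mulmxA -map_mxM Th map_mx0 mulmx0 mxE.
- move=> a; rewrite TC => aT; set c := covector_eval hC a.
  have ah : a *m hC = c%:M by apply/matrixP => i j; rewrite !ord1 [RHS]mxE.
  have xiT : xiC *m map_mx toC T = 0.
    by rewrite -map_mxM crT bracketxx /cr linear0 map_mx0.
  have xih : xiC *m hC = 1 by rewrite -map_mxM crh eta_xi map_scalar_mx /= rmorph1.
  have SCu : map_mx toC S \in unitmx by rewrite map_unitmx.
  apply/eqP; rewrite -subr_eq0; apply/eqP; apply: (can_inj (mulmxK SCu)).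
  rewrite mul0mx map_mxD map_mxM -/hC -/xiC mulmxDr mulmxBl aT -scalemxAl xiT.
  rewrite scaler0 subr0 add0r mulmxA mulmxBl ah -scalemxAl xih.
  by rewrite scalemx1 subrr mul0mx.
- move=> a a0 ah; have QCE : map_mx toC Q = contact_gram hC scC.
    rewrite /Q /contact_gram map_mxD map_mxM -map_trmx; congr (_ + _).
    by apply/row_matrixP => i; rewrite -map_row !rowK -map_trmx map_mxM.
  have QCu : contact_gram hC scC \in unitmx by rewrite -QCE map_unitmx.
  have /rV0Pn [j aj] : a *m contact_gram hC scC != 0.
    by apply: contraNneq a0 => aQ; rewrite -(mulmxK QCu a) aQ mul0mx.
  exists (delta_mx 0 j); apply: contraNneq aj => abj.
  have := contact_gramE hC scC a (delta_mx 0 j).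
  rewrite trmx_delta -colE mxE => ->.
  by rewrite abj [covector_eval _ a]ah mul0r addr0.
Qed.

End ReebKernel.

(** * Normal forms and models *)

(** The four models are one family in three parameters: the scalar by which x
    acts on span(u, v), the coefficient of y in [u, v], and whether xi acts on
    span(u, v) as a rotation or with eigenvalues 1 and -1. *)
Definition ds_scaling (K : fieldType) (m : ds_model) : K :=
  match m with g0_plus | g1_plus => 0 | _ => 2^-1 end.

Definition ds_uv_y (K : fieldType) (m : ds_model) : K :=
  match m with g0_plus | g1_plus => 0 | _ => 1 end.

Definition ds_rotation (K : fieldType) (m : ds_model) : K :=
  match m with g0_plus | g0_minus => 1 | _ => 0 end.

Lemma lie_isomorphic_ds_alg (K : numFieldType) (g : lieAlgType K) (m : ds_model)
    (xi x y u v : g)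
    (h := ds_scaling K m) (c := ds_uv_y K m) (r := ds_rotation K m) :
  \dim {:g} = 5%N -> <<[:: xi; x; y; u; v]>>%VS = fullv ->
  bracket xi x = 0 -> bracket xi y = 0 -> bracket x y = xi + y ->
  bracket u v = xi + c *: y ->
  bracket xi u = r *: v + (1 - r) *: u ->
  bracket xi v = - r *: u - (1 - r) *: v ->
  bracket x u = h *: u -> bracket x v = h *: v ->
  bracket y u = - bracket xi u -> bracket y v = - bracket xi v ->
  lie_isomorphic g (ds_alg K m).
Proof.
move=> dimg span xix xiy xy uv xiu xiv xu xv yu yv.
pose X := [tuple xi; x; y; u; v].
have Xb : basis_of fullv X by rewrite basisEdim span subvv dimg.
pose F (w : 'rV[K]_5) : g := w 0 (inord 0) *: xi + w 0 (inord 1) *: x +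
  w 0 (inord 2) *: y + w 0 (inord 3) *: u + w 0 (inord 4) *: v.
have FK a : F (coords X a) = a.
  rewrite [RHS](coord_basis Xb (memvf a)) !big_ord_recl big_ord0 /F !mxE /=.
  rewrite addr0 !addrA; congr (_ + _ + _ + _ + _); congr (coord X _ a *: _);
    by apply: val_inj; rewrite /= inordK.
have brF w z : bracket (F w) (F z) = F (bracket (w : ds_alg K m) z).
  have [E0 E1 E2 E3 E4] := ds_bracketE m w z.
  rewrite /F E0 E1 E2 E3 E4 !bracketE !bracketxx.
  rewrite ![bracket _ xi]bracketC ![bracket y x]bracketC.
  rewrite [bracket u x]bracketC [bracket v x]bracketC [bracket u y]bracketC.
  rewrite [bracket v y]bracketC [bracket v u]bracketC.
  rewrite xix xiy xy uv xu xv yu yv xiu xiv /h /c /r.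
  clear; case: m => /=; vector_coordinates; ring.
exists (linfun (coords X : g -> ds_alg K m)).
have fE a : linfun (coords X : g -> ds_alg K m) a = coords X a by rewrite lfunE.
have coordsF w : coords X (F w) = w.
  by have [a <-] := coords_surj Xb w; rewrite FK.
split; first by exists F => a; rewrite fE.
move=> a b; rewrite !fE; apply: (can_inj coordsF).
by rewrite -brF !FK.
Qed.

Section SplitForm.
Variables (R : rcfType) (g : lieAlgType R).
Hypothesis dimg : \dim {:g} = 5%N.
Implicit Types (xi x w u v : g) (d h c m : R).

(** The normal form reached by a DS-contact algebra before rescaling; the vector
    called y in the models is [w - xi]. *)
Definition split_form xi x w u v d h c m : Prop :=
  [/\ <<[:: xi; x; w; u; v]>>%VS = fullv,
      [/\ bracket xi x = 0, bracket xi w = 0, bracket x w = w,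
          bracket xi u = v & bracket xi v = d *: u] &
      [/\ bracket x u = h *: u, bracket x v = h *: v,
          bracket w u = 0, bracket w v = 0 & bracket u v = c *: xi + m *: w]].

Lemma mem_span5 (a b c d e z : g) (k1 k2 k3 k4 k5 : R) :
  z = k1 *: a + k2 *: b + k3 *: c + k4 *: d + k5 *: e ->
  z \in <<[:: a; b; c; d; e]>>%VS.
Proof.
by move=> ->; rewrite !rpredD // rpredZ // memv_span // !inE eqxx ?orbT.
Qed.

Lemma span_full (s t : seq g) : <<s>>%VS = fullv ->
  (forall a, a \in s -> a \in <<t>>%VS) -> <<t>>%VS = fullv.
Proof.
move=> sf st; apply/eqP; rewrite eqEsubv subvf -sf.
exact/span_subvP.
Qed.

Lemma span_full5 (a b c d e : g) (t : seq g) : <<[:: a; b; c; d; e]>>%VS = fullv ->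
  a \in <<t>>%VS -> b \in <<t>>%VS -> c \in <<t>>%VS -> d \in <<t>>%VS ->
  e \in <<t>>%VS -> <<t>>%VS = fullv.
Proof.
move=> sf ta tb tc td te; apply: (span_full sf) => z.
by rewrite !inE => /or4P [/eqP->|/eqP->|/eqP->|/orP[]/eqP->].
Qed.

(** In the following four lemmas xi is divided by a square root [s] of [d] or
    [- d], so that [ad xi] squares to 1 or to -1 on span(u, v). *)
Lemma split_form_minus_elliptic xi x w u v d m : d < 0 -> m != 0 ->
  split_form xi x w u v d 2^-1 0 m -> lie_isomorphic g (ds_alg R g0_minus).
Proof.
move=> d0 m0 [span [xix xiw xw xiu xiv] [xu xv wu wv uv]].
pose s := Num.sqrt (- d).
have s2 : s * s = - d by rewrite -expr2 sqr_sqrtr ?oppr_ge0 ?ltW.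
have s0 : s != 0 by rewrite sqrtr_eq0 -ltNge oppr_gt0.
have dE : d = - (s * s) by rewrite s2 opprK.
(* The third vector is [u, v / s] minus the new xi.                             *)
apply: (@lie_isomorphic_ds_alg _ g g0_minus (s^-1 *: xi) x
   ((m / s) *: w - s^-1 *: xi) u (s^-1 *: v)) => //=; rewrite ?bracketE.
- apply: (span_full5 span).
  + by apply: (@mem_span5 _ _ _ _ _ _ s 0 0 0 0); vector_coordinates; field.
  + by apply: (@mem_span5 _ _ _ _ _ _ 0 1 0 0 0); vector_coordinates; field.
  + apply: (@mem_span5 _ _ _ _ _ _ (s / m) 0 (s / m) 0 0).
    by vector_coordinates; field; rewrite m0 s0.
  + by apply: (@mem_span5 _ _ _ _ _ _ 0 0 0 1 0); vector_coordinates; field.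
  + by apply: (@mem_span5 _ _ _ _ _ _ 0 0 0 0 s); vector_coordinates; field.
- by rewrite xix scaler0.
- by rewrite xiw bracketxx !(scaler0, oppr0, addr0).
- by rewrite xw [bracket x xi]bracketC xix; vector_coordinates; field.
- by rewrite uv; vector_coordinates; field.
- by rewrite xiu; vector_coordinates; field.
- by rewrite xiv dE; vector_coordinates; field.
- by rewrite xv; vector_coordinates; field.
- by rewrite wu xiu; vector_coordinates; field.
- by rewrite wv xiv; vector_coordinates; field.
Qed.

Lemma split_form_minus_hyperbolic xi x w u v d m : 0 < d -> m != 0 ->
  split_form xi x w u v d 2^-1 0 m -> lie_isomorphic g (ds_alg R g1_minus).
Proof.
move=> d0 m0 [span [xix xiw xw xiu xiv] [xu xv wu wv uv]].
pose s := Num.sqrt d; have s2 : s * s = d by rewrite -expr2 sqr_sqrtr ?ltW.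
have s0 : s != 0 by rewrite sqrtr_eq0 -ltNge.
(* u + v / s and u - v / s are eigenvectors of ad xi, with bracket             *)
(* - (2 m / s) w.                                                             *)
apply: (@lie_isomorphic_ds_alg _ g g1_minus (s^-1 *: xi) x
   (- (2 * m / s) *: w - s^-1 *: xi) (u + s^-1 *: v) (u - s^-1 *: v)) => //=;
  rewrite ?bracketE.
- apply: (span_full5 span).
  + apply: (@mem_span5 _ _ _ _ _ _ s 0 0 0 0).
    by vector_coordinates; field; rewrite ?m0 ?s0.
  + apply: (@mem_span5 _ _ _ _ _ _ 0 1 0 0 0).
    by vector_coordinates; field; rewrite ?m0 ?s0.
  + apply: (@mem_span5 _ _ _ _ _ _ (- (s / (2 * m))) 0 (- (s / (2 * m))) 0 0).
    by vector_coordinates; field; rewrite ?m0 ?s0.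
  + apply: (@mem_span5 _ _ _ _ _ _ 0 0 0 2^-1 2^-1).
    by vector_coordinates; field; rewrite ?m0 ?s0.
  + apply: (@mem_span5 _ _ _ _ _ _ 0 0 0 (s / 2) (- (s / 2))).
    by vector_coordinates; field; rewrite ?m0 ?s0.
- by rewrite xix scaler0.
- by rewrite xiw bracketxx !(scaler0, oppr0, addr0).
- by rewrite xw [bracket x xi]bracketC xix; vector_coordinates; field.
- by rewrite [bracket v u]bracketC uv !bracketxx; vector_coordinates; field.
- by rewrite xiu xiv -s2; vector_coordinates; field.
- by rewrite xiu xiv -s2; vector_coordinates; field.
- by rewrite xu xv; vector_coordinates; field.
- by rewrite xu xv; vector_coordinates; field.
- by rewrite wu wv xiu xiv; vector_coordinates; field.
- by rewrite wu wv xiu xiv; vector_coordinates; field.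
Qed.

Lemma split_form_plus_hyperbolic xi x w u v d c : 0 < d -> c != 0 ->
  split_form xi x w u v d 0 c 0 -> lie_isomorphic g (ds_alg R g1_plus).
Proof.
move=> d0 c0 [span [xix xiw xw xiu xiv] [xu xv wu wv uv]].
pose s := Num.sqrt d; have s2 : s * s = d by rewrite -expr2 sqr_sqrtr ?ltW.
have s0 : s != 0 by rewrite sqrtr_eq0 -ltNge.
(* The eigenvectors u + v / s and u - v / s have bracket - (2 c / s) xi, which *)
(* the factor - 1 / (2 c) turns into xi / s.                                   *)
apply: (@lie_isomorphic_ds_alg _ g g1_plus (s^-1 *: xi) x (w - s^-1 *: xi)
   (- (2 * c)^-1 *: (u + s^-1 *: v)) (u - s^-1 *: v)) => //=;
  rewrite ?bracketE.
- apply: (span_full5 span).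
  + apply: (@mem_span5 _ _ _ _ _ _ s 0 0 0 0).
    by vector_coordinates; field; rewrite ?s0 ?c0.
  + apply: (@mem_span5 _ _ _ _ _ _ 0 1 0 0 0).
    by vector_coordinates; field; rewrite ?s0 ?c0.
  + apply: (@mem_span5 _ _ _ _ _ _ 1 0 1 0 0).
    by vector_coordinates; field; rewrite ?s0 ?c0.
  + apply: (@mem_span5 _ _ _ _ _ _ 0 0 0 (- c) 2^-1).
    by vector_coordinates; field; rewrite ?s0 ?c0.
  + apply: (@mem_span5 _ _ _ _ _ _ 0 0 0 (- (c * s)) (- (s / 2))).
    by vector_coordinates; field; rewrite ?s0 ?c0.
- by rewrite xix scaler0.
- by rewrite xiw bracketxx !(scaler0, oppr0, addr0).
- by rewrite xw [bracket x xi]bracketC xix; vector_coordinates; field; rewrite ?s0 ?c0.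
- by rewrite [bracket v u]bracketC uv !bracketxx; vector_coordinates; field; rewrite ?s0 ?c0.
- by rewrite xiu xiv -s2; vector_coordinates; field; rewrite ?s0 ?c0.
- by rewrite xiu xiv -s2; vector_coordinates; field; rewrite ?s0 ?c0.
- by rewrite xu xv; vector_coordinates; field; rewrite ?s0 ?c0.
- by rewrite xu xv; vector_coordinates; field; rewrite ?s0 ?c0.
- by rewrite wu wv xiu xiv; vector_coordinates; field; rewrite ?s0 ?c0.
- by rewrite wu wv xiu xiv; vector_coordinates; field; rewrite ?s0 ?c0.
Qed.

Lemma split_form_plus_elliptic xi x w u v d c : d < 0 -> 0 < c ->
  split_form xi x w u v d 0 c 0 -> lie_isomorphic g (ds_alg R g0_plus).
Proof.
move=> d_lt0 c_gt0 [span [xix xiw xw xiu xiv] [xu xv wu wv uv]].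
pose s := Num.sqrt (- d).
have s2 : s * s = - d by rewrite -expr2 sqr_sqrtr ?oppr_ge0 ?ltW.
have s0 : s != 0 by rewrite sqrtr_eq0 -ltNge oppr_gt0.
have dE : d = - (s * s) by rewrite s2 opprK.
(* [u, v] = c xi is normalized by dividing u and v by a square root of c.      *)
pose k := Num.sqrt c; have k2 : k * k = c by rewrite -expr2 sqr_sqrtr ?ltW.
have c0 : k != 0 by rewrite sqrtr_eq0 -ltNge.
apply: (@lie_isomorphic_ds_alg _ g g0_plus (s^-1 *: xi) x (w - s^-1 *: xi)
   (k^-1 *: u) ((k * s)^-1 *: v)) => //=; rewrite ?bracketE.
- apply: (span_full5 span).
  + apply: (@mem_span5 _ _ _ _ _ _ s 0 0 0 0).
    by vector_coordinates; field; rewrite ?s0 ?c0.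
  + apply: (@mem_span5 _ _ _ _ _ _ 0 1 0 0 0).
    by vector_coordinates; field; rewrite ?s0 ?c0.
  + apply: (@mem_span5 _ _ _ _ _ _ 1 0 1 0 0).
    by vector_coordinates; field; rewrite ?s0 ?c0.
  + apply: (@mem_span5 _ _ _ _ _ _ 0 0 0 k 0).
    by vector_coordinates; field; rewrite ?s0 ?c0.
  + apply: (@mem_span5 _ _ _ _ _ _ 0 0 0 0 (k * s)).
    by vector_coordinates; field; rewrite ?s0 ?c0.
- by rewrite xix scaler0.
- by rewrite xiw bracketxx !(scaler0, oppr0, addr0).
- by rewrite xw [bracket x xi]bracketC xix; vector_coordinates; field; rewrite ?s0 ?c0.
- by rewrite uv -k2; vector_coordinates; field; rewrite ?s0 ?c0.
- by rewrite xiu; vector_coordinates; field; rewrite ?s0 ?c0.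
- by rewrite xiv dE; vector_coordinates; field; rewrite ?s0 ?c0.
- by rewrite xu; vector_coordinates; field; rewrite ?s0 ?c0.
- by rewrite xv; vector_coordinates; field; rewrite ?s0 ?c0.
- by rewrite wu xiu; vector_coordinates; field; rewrite ?s0 ?c0.
- by rewrite wv xiv; vector_coordinates; field; rewrite ?s0 ?c0.
Qed.

(** In the direct sum case, xi and u play symmetric roles in the
    three-dimensional summand span(xi, u, v).  When [d] and [c] are negative,
    [ad xi] is elliptic, but [ad u] has real nonzero eigenvalues: the summand is
    sl(2) and not so(3). *)
Lemma split_form_swap xi x w u v d c :
  split_form xi x w u v d 0 c 0 -> split_form u x w xi (- v) (- c) 0 (- d) 0.
Proof.
move=> [span [xix xiw xw xiu xiv] [xu xv wu wv uv]]; split.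
- apply: (span_full5 span).
  + by apply: (@mem_span5 _ _ _ _ _ _ 0 0 0 1 0); vector_coordinates; ring.
  + by apply: (@mem_span5 _ _ _ _ _ _ 0 1 0 0 0); vector_coordinates; ring.
  + by apply: (@mem_span5 _ _ _ _ _ _ 0 0 1 0 0); vector_coordinates; ring.
  + by apply: (@mem_span5 _ _ _ _ _ _ 1 0 0 0 0); vector_coordinates; ring.
  + by apply: (@mem_span5 _ _ _ _ _ _ 0 0 0 0 (-1)); vector_coordinates; ring.
- rewrite ![bracket u _]bracketC !bracketE xu wu xiu [bracket v u]bracketC uv.
  by rewrite xw; split=> //; vector_coordinates; ring.
- rewrite !bracketE ![bracket _ xi]bracketC xix xiw xv wv xiv.
  by split; vector_coordinates; ring.
Qed.

Lemma split_form_ds_model xi x w u v d h c m : d != 0 ->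
  [/\ h = 0, m = 0 & c != 0] \/ [/\ h = 2^-1, c = 0 & m != 0] ->
  split_form xi x w u v d h c m -> exists k, lie_isomorphic g (ds_alg R k).
Proof.
move=> d0 [[-> -> c0]|[-> -> m0]] sf.
  have [d_lt0|d_gt0|/eqP] := ltgtP d 0; last by rewrite (negPf d0).
    have [c_lt0|c_gt0|/eqP] := ltgtP c 0; last by rewrite (negPf c0).
      exists g1_plus; apply: split_form_plus_hyperbolic (split_form_swap sf).
        by rewrite oppr_gt0.
      by rewrite oppr_eq0.
    by exists g0_plus; apply: split_form_plus_elliptic sf.
  by exists g1_plus; apply: split_form_plus_hyperbolic sf.
have [d_lt0|d_gt0|/eqP] := ltgtP d 0; last by rewrite (negPf d0).
  by exists g0_minus; apply: split_form_minus_elliptic sf.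
by exists g1_minus; apply: split_form_minus_hyperbolic sf.
Qed.

Lemma span_free5 (a b c d f : g) :
  (forall k1 k2 k3 k4 k5 : R,
     k1 *: a + k2 *: b + k3 *: c + k4 *: d + k5 *: f = 0 ->
     [/\ k1 = 0, k2 = 0, k3 = 0, k4 = 0 & k5 = 0]) ->
  <<[:: a; b; c; d; f]>>%VS = fullv.
Proof.
move=> indep; apply/eqP; rewrite eqEdim subvf dimg.
suff : free [tuple a; b; c; d; f] by move/eqP => ->.
apply/freeP => k; rewrite !big_ord_recl big_ord0 addr0 !addrA /=.
move=> /indep [k1 k2 k3 k4 k5] [[|[|[|[|[|//]]]]] ?].
- by rewrite -[RHS]k1; congr k; apply: val_inj.
- by rewrite -[RHS]k2; congr k; apply: val_inj.
- by rewrite -[RHS]k3; congr k; apply: val_inj.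
- by rewrite -[RHS]k4; congr k; apply: val_inj.
- by rewrite -[RHS]k5; congr k; apply: val_inj.
Qed.

Lemma span5P (a b c d f z : g) : <<[:: a; b; c; d; f]>>%VS = fullv ->
  exists k1 k2 k3 k4 k5 : R,
    z = k1 *: a + k2 *: b + k3 *: c + k4 *: d + k5 *: f.
Proof.
move=> full; have : z \in <<[:: a; b; c; d; f]>>%VS by rewrite full memvf.
rewrite !span_cons span_nil addv0.
move=> /memv_addP [_ /vlineP [k1 ->] [z1 + ->]].
move=> /memv_addP [_ /vlineP [k2 ->] [z2 + ->]].
move=> /memv_addP [_ /vlineP [k3 ->] [z3 + ->]].
move=> /memv_addP [_ /vlineP [k4 ->] [_ /vlineP [k5 ->] ->]].
by exists k1, k2, k3, k4, k5; rewrite !addrA.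
Qed.

End SplitForm.

(** * Reduction of a DS-contact algebra to the normal form *)

Section NormalForm.
Variables (R : rcfType) (g : lieAlgType R) (eta : {linear g -> R^o}) (xi : g).
Hypothesis dimg : \dim {:g} = 5%N.
Hypothesis eta_xi : eta xi = 1.
Hypothesis eta_br : forall a, eta (bracket xi a) = 0.
Hypothesis nondeg :
  forall z, eta z = 0 -> (forall a, eta (bracket z a) = 0) -> z = 0.
Hypothesis ds : (lker (ad xi) + limg (ad xi))%VS = fullv.
Hypothesis center : trivial_center g.

(* A copy of eta with values in R rather than in R as a module over itself.    *)
Let e : g -> R := eta.
Let eD : {morph e : a b / a + b}. Proof. exact: raddfD. Qed.
Let eN : {morph e : a / - a}. Proof. exact: raddfN. Qed.
Let eZ k a : e (k *: a) = k * e a. Proof. by rewrite /e linearZ. Qed.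
Let e0 : e 0 = 0. Proof. exact: raddf0. Qed.
Let eE := (eD, eN, eZ, e0).
Let e_xi : e xi = 1. Proof. exact: eta_xi. Qed.
Let e_br a : e (bracket xi a) = 0. Proof. exact: eta_br. Qed.

Let ds_split z : exists n b, bracket xi n = 0 /\ z = n + bracket xi b.
Proof.
have : z \in (lker (ad xi) + limg (ad xi))%VS by rewrite ds memvf.
move=> /memv_addP [n nN [p /memv_imgP [b _ ->] ->]]; exists n, b.
by move: nN; rewrite memv_ker !lfunE => /eqP.
Qed.

Let orth n b : bracket xi n = 0 -> e (bracket n (bracket xi b)) = 0.
Proof.
move=> xin; rewrite bracket_der [bracket n xi]bracketC xin oppr0 bracket0l.
by rewrite add0r e_br.
Qed.

Let skew a b : e (bracket (bracket xi a) b) = - e (bracket a (bracket xi b)).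
Proof. by apply/eqP; rewrite -addr_eq0 -eD -bracket_der e_br. Qed.

(** The kernel of [ad xi] is not a line, so it meets the kernel of [eta]
    nontrivially, and [d eta] is nondegenerate on the intersection. *)
Let kernel_pair : exists n m, [/\ bracket xi n = 0, bracket xi m = 0,
  e n = 0, e m = 0 & e (bracket n m) != 0].
Proof.
have [n0 [xin0 n0N]] : exists n, bracket xi n = 0 /\ n <> eta n *: xi.
  apply: contrapT => noN; apply: (reeb_kernel_not_line dimg eta_xi eta_br nondeg).
  by move=> a xia; apply: contrapT => aN; apply: noN; exists a.
pose proj a := a - e a *: xi.
have xi_proj a : bracket xi (proj a) = bracket xi a.
  by rewrite !bracketE bracketxx scaler0 oppr0 addr0.
have e_proj a : e (proj a) = 0 by rewrite !eE e_xi mulr1 subrr.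
have [m [xim nm]] : exists m, bracket xi m = 0 /\ e (bracket (proj n0) m) <> 0.
  apply: contrapT => nom; apply: n0N; apply/eqP; rewrite -subr_eq0; apply/eqP.
  apply: nondeg => [|a]; first exact: e_proj.
  have [m [b [xim ->]]] := ds_split a.
  rewrite bracketDr -/e eD orth ?xi_proj // addr0.
  by apply: contrapT => nm; apply: nom; exists m.
exists (proj n0), (proj m); rewrite !xi_proj !e_proj; split=> //.
rewrite /proj bracketDr bracketNr bracketZr [bracket _ xi]bracketC xi_proj xin0.
by rewrite oppr0 scaler0 oppr0 addr0; apply/eqP.
Qed.

(** With T = ad xi, [d eta (u, T u')] is a symmetric bilinear form on the image
    of T.  It is not zero, hence neither is its quadratic form, by
    polarization. *)
Let image_vector :
  exists b, let u := bracket xi b in e (bracket u (bracket xi u)) != 0.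
Proof.
have [b xib] : exists b, bracket xi b <> 0.
  apply: contrapT => nob; have : xi = 0.
    by apply: center => a; apply: contrapT => xia; apply: nob; exists a.
  move=> xi0; have := e_xi; rewrite xi0 e0 => /eqP.
  by rewrite eqtype.eq_sym oner_eq0.
have [c pc] : exists c, e (bracket (bracket xi b) (bracket xi (bracket xi c))) <> 0.
  apply: contrapT => noc; apply: xib; apply: nondeg => [|a]; first exact: e_br.
  have [n [c [xin ->]]] := ds_split a.
  rewrite bracketDr -/e eD [bracket _ n]bracketC eN orth // oppr0 add0r.
  have [n' [d [xin' ->]]] := ds_split c; rewrite bracketDr xin' add0r.
  by apply: contrapT => h; apply: noc; exists d.
pose Q a := e (bracket (bracket xi a) (bracket xi (bracket xi a))).
have QD : Q (b + c) = Q b + Q c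
    + 2 * e (bracket (bracket xi b) (bracket xi (bracket xi c))).
  have := skew (bracket xi c) (bracket xi b).
  rewrite [bracket (bracket xi (bracket xi c)) _]bracketC eN /Q.
  rewrite !bracketE !eE => /oppr_inj ->.
  by ring.
have [Qb|] := eqVneq (Q b) 0; last by exists b.
have [Qc|] := eqVneq (Q c) 0; last by exists c.
have Qbc : Q (b + c) != 0.
  by rewrite QD Qb Qc !add0r mulf_eq0 pnatr_eq0 /=; apply/eqP.
by exists (b + c).
Qed.

(** The basis xi, n, m, u, v is orthogonal for [d eta] except for the two pairs
    n, m and u, v, so that coordinates are read off by pairing.  Then n and m
    are replaced by x and w = [n, m]. *)
Lemma ds_split_form : exists (xi x w u v : g) (d h c m : R), [/\ d != 0,
  [/\ h = 0, m = 0 & c != 0] \/ [/\ h = 2^-1, c = 0 & m != 0] &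
  split_form xi x w u v d h c m].
Proof.
have [n [m [xin xim en em nm]]] := kernel_pair.
have [b /=] := image_vector; set u := bracket xi b; set v := bracket xi u => uv.
have eu : e u = 0 by exact: e_br.
have ev : e v = 0 by exact: e_br.
have vu : e (bracket v u) = - e (bracket u v) by rewrite bracketC eN.
have w_xi z : e (bracket z xi) = 0 by rewrite bracketC eN e_br oppr0.
have w_self z : e (bracket z z) = 0 by rewrite bracketxx e0.
have [nu nv] : e (bracket n u) = 0 /\ e (bracket n v) = 0 by split; apply: orth.
have [mu mv] : e (bracket m u) = 0 /\ e (bracket m v) = 0 by split; apply: orth.
have [un vn] : e (bracket u n) = 0 /\ e (bracket v n) = 0.
  by rewrite ![bracket _ n]bracketC !eN nu nv oppr0.
have [um vm] : e (bracket u m) = 0 /\ e (bracket v m) = 0.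
  by rewrite ![bracket _ m]bracketC !eN mu mv oppr0.
have mn : e (bracket m n) = - e (bracket n m) by rewrite bracketC eN.
have pair z k1 k2 k3 k4 k5 :
    e (bracket z (k1 *: xi + k2 *: n + k3 *: m + k4 *: u + k5 *: v)) =
    k2 * e (bracket z n) + k3 * e (bracket z m) + k4 * e (bracket z u)
    + k5 * e (bracket z v).
  by rewrite !(bracketDr, bracketZr) !eE w_xi mulr0 add0r.
have full : <<[:: xi; n; m; u; v]>>%VS = fullv.
  apply: (span_free5 dimg) => k1 k2 k3 k4 k5 K.
  have K' z := pair z k1 k2 k3 k4 k5; rewrite K in K'.
  have := (K' n, K' m, K' u, K' v) => -[[[+ +] +] +].
  rewrite !bracket0r e0 !w_self nu nv mu mv un vn um vm mn vu.
  rewrite !(mulr0, addr0, add0r, mulrN).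
  move=> /esym /eqP; rewrite mulf_eq0 (negPf nm) orbF => /eqP k30.
  move=> /esym /eqP; rewrite oppr_eq0 mulf_eq0 (negPf nm) orbF => /eqP k20.
  move=> /esym /eqP; rewrite mulf_eq0 (negPf uv) orbF => /eqP k50.
  move=> /esym /eqP; rewrite oppr_eq0 mulf_eq0 (negPf uv) orbF => /eqP k40.
  have := congr1 e K; rewrite !eE e_xi en em eu ev !mulr0 !addr0 mulr1 => k10.
  by [].
have kernelE z : bracket xi z = 0 -> exists k1 k2 k3, z = k1 *: xi + k2 *: n + k3 *: m.
  move=> xiz; have [k1 [k2 [k3 [k4 [k5 zE]]]]] := span5P z full.
  have := pair u k1 k2 k3 k4 k5; have := pair v k1 k2 k3 k4 k5.
  have zu : e (bracket z u) = 0 by exact: orth.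
  have zv : e (bracket z v) = 0 by exact: orth.
  rewrite -zE [bracket v z]bracketC [bracket u z]bracketC !eN zu zv !w_self un vn um vm vu.
  rewrite !(mulr0, addr0, add0r, mulrN, oppr0).
  move=> /esym /eqP; rewrite oppr_eq0 mulf_eq0 (negPf uv) orbF => /eqP k40.
  move=> /esym /eqP; rewrite mulf_eq0 (negPf uv) orbF => /eqP k50.
  by exists k1, k2, k3; rewrite zE k40 k50 !scale0r !addr0.
have imageE z : exists k4 k5, bracket xi z = k4 *: u + k5 *: v.
  have [k1 [k2 [k3 [k4 [k5 zE]]]]] := span5P (bracket xi z) full.
  have := pair n k1 k2 k3 k4 k5; have := pair m k1 k2 k3 k4 k5.
  have nz : e (bracket n (bracket xi z)) = 0 by exact: orth.
  have mz : e (bracket m (bracket xi z)) = 0 by exact: orth.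
  rewrite -zE nz mz !w_self nu nv mu mv mn.
  rewrite !(mulr0, addr0, add0r, mulrN, oppr0).
  move=> /esym /eqP; rewrite oppr_eq0 mulf_eq0 (negPf nm) orbF => /eqP k20.
  move=> /esym /eqP; rewrite mulf_eq0 (negPf nm) orbF => /eqP k30.
  have := congr1 e zE; rewrite e_br !eE e_xi en em eu ev !mulr0 !addr0 mulr1 => k10.
  by exists k4, k5; rewrite zE -k10 k20 k30 !scale0r !add0r.
have u0 : u <> 0 by move=> u0; move: uv; rewrite u0 bracket0l e0 eqxx.
have v0 : v <> 0 by move=> v0; move: uv; rewrite v0 bracket0r e0 eqxx.
have [d [d0 xiv]] : exists d, d != 0 /\ bracket xi v = d *: u.
  have [d [d' xiv]] := imageE v.
  have d'0 : d' = 0.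
    have := skew u v; rewrite -/v xiv bracketxx e0 bracketDr !bracketZr bracketxx scaler0 add0r.
    by rewrite eZ => /eqP; rewrite eqtype.eq_sym oppr_eq0 mulf_eq0 (negPf uv) orbF => /eqP.
  exists d; rewrite {1}xiv d'0 scale0r addr0; split=> //.
  apply: contraNneq uv => d0; apply/eqP.
  have : bracket xi v = 0 by rewrite xiv d'0 d0 !scale0r addr0.
  by move=> xiv0; rewrite bracketC eN (orth b xiv0) oppr0.
have uv_indep k l : k *: u + l *: v = 0 -> k = 0 /\ l = 0.
  move=> K; have := (congr1 (fun z => e (bracket u z)) K, congr1 (fun z => e (bracket v z)) K).
  rewrite !(bracketDr, bracketZr) !eE !bracket0r e0 !w_self vu !(mulr0, addr0, add0r).
  case=> /eqP; rewrite mulf_eq0 (negPf uv) orbF => /eqP -> /eqP.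
  by rewrite mulf_eq0 oppr_eq0 (negPf uv) orbF => /eqP ->.
(* A kernel element acts on span(u, v) as h + s T, since it commutes with T.   *)
have action a : bracket xi a = 0 -> exists h s, bracket a u = h *: u + s *: v
    /\ bracket a v = h *: v + (s * d) *: u.
  move=> xia; have comm z : bracket a (bracket xi z) = bracket xi (bracket a z).
    by rewrite bracket_der [bracket a xi]bracketC xia oppr0 bracket0l add0r.
  have [h [s hs]] := imageE (bracket a b); rewrite -comm in hs; exists h, s.
  split=> //; rewrite /v comm hs bracketDr !bracketZr -/v xiv; vector_coordinates; ring.
have [h1 [s1 [n_u n_v]]] := action n xin; have [h2 [s2 [m_u m_v]]] := action m xim.
(* w acts on span(u, v) as a commutator of polynomials in T.                  *)
pose w := bracket n m.
have xiw : bracket xi w = 0 by rewrite bracket_der xin xim bracket0l bracket0r addr0.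
have wu : bracket w u = 0.
  rewrite bracket_ad m_u n_u !bracketE n_u n_v m_u m_v; vector_coordinates; ring.
have wv : bracket w v = 0.
  by rewrite bracket_der [bracket w xi]bracketC xiw oppr0 bracket0l add0r wu bracket0r.
have [k1 [p [q wE]]] := kernelE w xiw.
(* w is not a multiple of xi because T u = v is nonzero.                       *)
have [x1 [xix1 x1w]] : exists x1, bracket xi x1 = 0 /\ bracket x1 w = w.
  have [q0|q0] := eqVneq q 0.
    have [p0|p0] := eqVneq p 0.
      have k10 : k1 != 0.
        by apply: contraNneq nm => k10; rewrite -/w wE k10 p0 q0 !scale0r !addr0 e0.
      have /eqP := wu; rewrite wE p0 q0 !scale0r !addr0 bracketZl -/v scaler_eq0 (negPf k10) /=.
      by move/eqP.
    exists (- p^-1 *: m); rewrite bracketZr xim scaler0; split=> //.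
    rewrite {1}wE q0 !bracketE bracketxx [bracket m xi]bracketC xim [bracket m n]bracketC -/w.
    by vector_coordinates; field.
  exists (q^-1 *: n); rewrite bracketZr xin scaler0; split=> //.
  rewrite {1}wE !bracketE bracketxx [bracket n xi]bracketC xin -/w.
  by vector_coordinates; field.
have [h [s [x1u x1v]]] := action x1 xix1.
pose x := x1 - s *: xi.
have xix : bracket xi x = 0 by rewrite /x !bracketE bracketxx xix1; vector_coordinates; ring.
have xw : bracket x w = w by rewrite /x !bracketE x1w xiw; vector_coordinates; ring.
have xu : bracket x u = h *: u by rewrite /x !bracketE x1u -/v; vector_coordinates; ring.
have xv : bracket x v = h *: v by rewrite /x !bracketE x1v xiv; vector_coordinates; ring.
have w0 : w != 0 by apply: contraNneq nm => w0; rewrite -/w w0 e0.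
have wx : bracket w x = - w by rewrite bracketC xw.
clearbody x w.
have xi_u_indep k l : k *: xi + l *: w = 0 -> k = 0.
  move=> /(congr1 (fun z => bracket z u)); rewrite !bracketE wu scaler0 addr0 -/v => /eqP.
  by rewrite scaler_eq0 => /orP [/eqP|/eqP] // /v0.
have full' : <<[:: xi; x; w; u; v]>>%VS = fullv.
  apply: (span_free5 dimg) => l1 l2 l3 l4 l5 K.
  have := congr1 (bracket w) K; rewrite !bracketE [bracket w xi]bracketC xiw bracketxx wu wv wx.
  rewrite !(scaler0, oppr0, addr0, add0r) scalerN => /eqP.
  rewrite oppr_eq0 scaler_eq0 (negPf w0) orbF => /eqP l20.
  have := congr1 (bracket xi) K; rewrite !bracketE bracketxx xix xiw -/v xiv scalerA.
  rewrite !(scaler0, addr0, add0r) addrC => /uv_indep [/eqP + l40].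
  rewrite mulf_eq0 (negPf d0) orbF => /eqP l50.
  move: K; rewrite l20 l40 l50 !scale0r !addr0 => K; have l10 := xi_u_indep _ _ K.
  move: K => /eqP; rewrite l10 scale0r add0r scaler_eq0 (negPf w0) orbF => /eqP ->.
  by split.
have xi_uv : bracket xi (bracket u v) = 0.
  by rewrite bracket_der -/v bracketxx xiv bracketZr bracketxx scaler0 addr0.
have [c [l [m' [k4 [k5 uvE]]]]] := span5P (bracket u v) full'.
have [k50 k40] : k5 = 0 /\ k4 = 0.
  have := xi_uv; rewrite uvE !bracketE bracketxx xix xiw -/v xiv scalerA.
  rewrite !(scaler0, addr0, add0r) addrC => /uv_indep [/eqP + ->].
  by rewrite mulf_eq0 (negPf d0) orbF => /eqP ->.
rewrite k40 k50 !scale0r !addr0 in uvE.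
(* The Jacobi identity for w, u, v gives l = 0, the one for x, u, v gives der. *)
have l0 : l = 0.
  have := bracket_der w u v; rewrite wu wv bracket0l bracket0r addr0 uvE !bracketE wx bracketxx.
  rewrite [bracket w xi]bracketC xiw !(scaler0, oppr0, addr0, add0r) scalerN => /eqP.
  by rewrite oppr_eq0 scaler_eq0 (negPf w0) orbF => /eqP.
rewrite l0 scale0r addr0 in uvE.
have der : (2 * h * c) *: xi + (2 * h * m' - m') *: w = 0.
  have := bracket_der x u v; rewrite xu xv bracketZl bracketZr uvE !bracketE xw.
  rewrite [bracket x xi]bracketC xix => E.
  have -> : (2 * h * c) *: xi + (2 * h * m' - m') *: w =
    h *: (c *: xi + m' *: w) + h *: (c *: xi + m' *: w) - (c *: - 0 + m' *: w).
    by vector_coordinates; ring.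
  by rewrite -!scalerDr E !scalerDr subrr.
have hc := xi_u_indep _ _ der.
have hm : 2 * h * m' - m' = 0.
  move: der => /eqP; rewrite hc scale0r add0r scaler_eq0 (negPf w0) orbF.
  by move/eqP.
have cm : c != 0 \/ m' != 0.
  have [c0|] := eqVneq c 0; last by left.
  right; apply: contraNneq uv => m0; by rewrite uvE c0 m0 !scale0r addr0 e0.
exists xi, x, w, u, v, d, h, c, m'; split=> //.
have [h0|h0] := eqVneq h 0.
  left; have m0 : m' = 0.
    by move: hm => /eqP; rewrite h0 mulr0 mul0r sub0r oppr_eq0 => /eqP.
  by split=> //; case: cm; rewrite ?m0 ?eqxx.
right; have c0 : c = 0.
  by move: hc => /eqP; rewrite !mulf_eq0 (negPf h0) pnatr_eq0 => /eqP.
have m0 : m' != 0 by case: cm; rewrite ?c0 ?eqxx.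
split=> //; apply: (mulIf m0); apply/eqP; rewrite -subr_eq0.
have -> : h * m' - 2^-1 * m' = 2^-1 * (2 * h * m' - m') by field.
by rewrite hm mulr0.
Qed.

End NormalForm.

(** * The four models are pairwise nonisomorphic *)

Section Invariants.
Variables (K : fieldType).

(** The derived algebra is nilpotent of class at most 2: by multilinearity it is
    enough to look at brackets instead of at their sums. *)
Definition derived_class2 (g : lieAlgType K) : Prop :=
  forall a b c d e f : g,
    bracket (bracket (bracket a b) (bracket c d)) (bracket e f) = 0.

Definition has_opposite_eigenvectors (g : lieAlgType K) : Prop :=
  exists a b b' : g, [/\ b != 0, b' != 0, bracket a b = b & bracket a b' = - b'].

Variables (g h : lieAlgType K).

Lemma derived_class2_iso : lie_isomorphic g h ->
  derived_class2 g <-> derived_class2 h.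
Proof.
move=> [f [[f' fK f'K] f_br]]; split=> H a b c d p q.
  rewrite -(f'K a) -(f'K b) -(f'K c) -(f'K d) -(f'K p) -(f'K q) -!f_br H.
  exact: linear0.
by apply: (can_inj fK); rewrite !f_br H linear0.
Qed.

Lemma has_opposite_eigenvectors_iso : lie_isomorphic g h ->
  has_opposite_eigenvectors g <-> has_opposite_eigenvectors h.
Proof.
move=> [f [[f' fK f'K] f_br]]; have f0 : f 0 = 0 := linear0 _.
split=> -[a [b [b' [b0 b'0 ab ab']]]].
  exists (f a), (f b), (f b'); split; rewrite -?f_br ?ab ?ab' ?linearN //;
    by rewrite -f0 (can_eq fK).
exists (f' a), (f' b), (f' b'); split; first by rewrite -(can_eq fK) f'K f0.
- by rewrite -(can_eq fK) f'K f0.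
- by apply: (can_inj fK); rewrite f_br !f'K.
- by apply: (can_inj fK); rewrite f_br raddfN /= !f'K.
Qed.

End Invariants.

Section ModelInvariants.
Variable R : realFieldType.
Implicit Types m : ds_model.

Definition vec5 (a0 a1 a2 a3 a4 : R) : 'rV[R]_5 :=
  \row_i [:: a0; a1; a2; a3; a4]`_i.

Lemma vec5E (a : 'rV[R]_5) : exists a0 a1 a2 a3 a4, a = vec5 a0 a1 a2 a3 a4.
Proof.
exists (a 0 (inord 0)), (a 0 (inord 1)), (a 0 (inord 2)), (a 0 (inord 3)), (a 0 (inord 4)).
apply/rowP => i; rewrite mxE; case: i => -[|[|[|[|[|//]]]]] ? /=;
  by congr (a 0 _); apply: val_inj; rewrite /= inordK.
Qed.

Lemma vec5_inj (a0 a1 a2 a3 a4 b0 b1 b2 b3 b4 : R) :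
  vec5 a0 a1 a2 a3 a4 = vec5 b0 b1 b2 b3 b4 ->
  [/\ a0 = b0, a1 = b1, a2 = b2, a3 = b3 & a4 = b4].
Proof.
move=> /rowP E; move: (E (inord 0)) (E (inord 1)) (E (inord 2)) (E (inord 3)) (E (inord 4)).
by rewrite !mxE !inordK.
Qed.

Lemma vec5_eq0 : vec5 0 0 0 0 0 = 0.
Proof. by apply/rowP => i; rewrite !mxE; case: i => -[|[|[|[|[|//]]]]]. Qed.

Lemma vec5N (a0 a1 a2 a3 a4 : R) :
  - vec5 a0 a1 a2 a3 a4 = vec5 (- a0) (- a1) (- a2) (- a3) (- a4).
Proof. by apply/rowP => i; rewrite !mxE; case: i => -[|[|[|[|[|//]]]]]. Qed.

Lemma ds_bracket_vec5 m (a0 a1 a2 a3 a4 b0 b1 b2 b3 b4 : R)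
    (h := ds_scaling R m) (c := ds_uv_y R m) (r := ds_rotation R m) :
  bracket (vec5 a0 a1 a2 a3 a4 : ds_alg R m) (vec5 b0 b1 b2 b3 b4 : ds_alg R m) =
  vec5 (a1 * b2 - a2 * b1 + (a3 * b4 - a4 * b3)) 0
    (a1 * b2 - a2 * b1 + c * (a3 * b4 - a4 * b3))
    (r * ((a2 - a0) * b4 - a4 * (b2 - b0)) + (1 - r) * ((a0 - a2) * b3 - a3 * (b0 - b2))
      + h * (a1 * b3 - a3 * b1))
    (r * ((a0 - a2) * b3 - a3 * (b0 - b2)) + (1 - r) * ((a2 - a0) * b4 - a4 * (b2 - b0))
      + h * (a1 * b4 - a4 * b1)).
Proof.
have := ds_bracketE m (vec5 a0 a1 a2 a3 a4) (vec5 b0 b1 b2 b3 b4).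
rewrite /vec5 !mxE !inordK //= -/(ds_scaling R m) -/(ds_uv_y R m) -/(ds_rotation R m).
case=> E0 E1 E2 E3 E4; apply/rowP => i; rewrite [RHS]mxE.
have iE : i = inord i by rewrite inord_val.
rewrite {1}iE; case: i {iE} => -[|[|[|[|[|//]]]]] ? /=.
- by rewrite E0.
- by rewrite E1.
- by rewrite E2.
- by rewrite E3 /h /r; ring.
- by rewrite E4 /h /r; ring.
Qed.

Let e0 := vec5 1 0 0 0 0.
Let e3 := vec5 0 0 0 1 0.
Let e4 := vec5 0 0 0 0 1.

(** In these models every bracket has coordinates (s, 0, s, t, w), and a bracket
    of two such vectors is a multiple of xi + y, which commutes with them. *)
Lemma derived_class2_minus m : ds_uv_y R m = 1 -> derived_class2 (ds_alg R m).
Proof.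
move=> c1 a b c d p q.
have der z z' : exists s t w, bracket (z : ds_alg R m) z' = vec5 s 0 s t w.
  have [z0 [z1 [z2 [z3 [z4 ->]]]]] := vec5E z.
  have [z'0 [z'1 [z'2 [z'3 [z'4 ->]]]]] := vec5E z'.
  by rewrite ds_bracket_vec5 c1 mul1r; do 3!eexists.
have [s1 [t1 [w1 ->]]] := der a b; have [s2 [t2 [w2 ->]]] := der c d.
have [s3 [t3 [w3 ->]]] := der p q.
by rewrite !ds_bracket_vec5 c1 -vec5_eq0; congr vec5; ring.
Qed.

(** xi, u and v span a perfect subalgebra. *)
Lemma derived_class2_plus m : ds_uv_y R m = 0 -> ds_scaling R m = 0 ->
  ds_rotation R m \in [:: 0; 1] -> ~ derived_class2 (ds_alg R m).
Proof.
move=> c0 h0 r01 /(_ e0 e3 e0 e4 e0 e3); rewrite !ds_bracket_vec5 c0 h0 -vec5_eq0.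
move=> /vec5_inj [_ _ _ E _].
suff : (-1 : R) = 0 by move/eqP; rewrite oppr_eq0 oner_eq0.
by move: r01 E; rewrite !inE => /orP [] /eqP -> <-; ring.
Qed.

Lemma has_opposite_eigenvectors_hyperbolic m : ds_rotation R m = 0 ->
  has_opposite_eigenvectors (ds_alg R m).
Proof.
move=> r0; exists e0, e3, e4.
have nz (b0 b1 b2 b3 b4 : R) : b3 + b4 = 1 -> vec5 b0 b1 b2 b3 b4 != 0.
  move=> b34; apply/eqP; rewrite -vec5_eq0 => /vec5_inj [_ _ _ b30 b40].
  by move: b34; rewrite b30 b40 addr0 => /eqP; rewrite eqtype.eq_sym oner_eq0.
split; [by apply: nz; rewrite addr0|by apply: nz; rewrite add0r|..];
  by rewrite ds_bracket_vec5 ?vec5N r0; congr vec5; ring.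
Qed.

(** The real eigenvalues of [ad a] are nonnegative multiples of the coordinate
    [a1] of [a] along x, because the remaining ones come from rotations.
    Concretely, if [a1 <= 0] then an eigenvector for the eigenvalue 1 has a
    vanishing sum of squares of coordinates. *)
Lemma eigenvalue1_elliptic m (a0 a1 a2 a3 a4 : R) (b : ds_alg R m) :
  m = g0_plus \/ m = g0_minus -> b != 0 ->
  bracket (vec5 a0 a1 a2 a3 a4 : ds_alg R m) b = b -> 0 < a1.
Proof.
have [b0 [b1 [b2 [b3 [b4 ->]]]]] := vec5E b; move=> m0 bn0.
rewrite ds_bracket_vec5 => /vec5_inj [E0 E1 E2 E3 E4].
move: bn0; apply: contraTT; rewrite -leNgt negbK => a1_le0; apply/eqP.
rewrite -vec5_eq0.
subst b1; have sq0 (x y z : R) : x * x + y * y + z * z = 0 -> [/\ x = 0, y = 0 & z = 0].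
  move=> /eqP; rewrite paddr_eq0 ?addr_ge0 -?expr2 ?sqr_ge0 //.
  rewrite paddr_eq0 ?sqr_ge0 // !sqrf_eq0.
  by move=> /andP [/andP [/eqP -> /eqP ->] /eqP ->].
have fix0 (k x : R) : k <= 0 -> k * x = x -> x = 0.
  move=> k0 kx; apply/eqP; have /eqP : (1 - k) * x = 0 by rewrite mulrBl kx mul1r subrr.
  by rewrite mulf_eq0 subr_eq0 => /orP [/eqP k1|//]; rewrite -k1 ler10 in k0.
case: m0 E0 E2 E3 E4 b => -> /= E0 E2 E3 E4 _.
  have b20 : b2 = 0 by apply: (fix0 a1) => //; rewrite -[RHS]E2; ring.
  subst b2; have [-> -> ->] // : [/\ b0 = 0, b3 = 0 & b4 = 0].
  apply: sq0; have P0 := congr1 (fun z => b0 * z) E0.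
  have P3 := congr1 (fun z => b3 * z) E3; have P4 := congr1 (fun z => b4 * z) E4.
  by rewrite -P0 -P3 -P4; ring.
have b02 : b0 = b2 by rewrite -[LHS]E0 -[RHS]E2; ring.
have h0 : 2^-1 * a1 <= 0 by rewrite pmulr_rle0 // invr_gt0 ltr0n.
have [_ b30 b40] : [/\ (0 : R) = 0, b3 = 0 & b4 = 0].
  have S : b3 * b3 + b4 * b4 = 2^-1 * a1 * (b3 * b3 + b4 * b4).
    have P3 := congr1 (fun z => b3 * z) E3; have P4 := congr1 (fun z => b4 * z) E4.
    by rewrite -[LHS](congr2 +%R P3 P4) b02; ring.
  apply: sq0; rewrite mul0r add0r; exact: (fix0 (2^-1 * a1)).
have b20 : b2 = 0 by apply: (fix0 a1) => //; rewrite -[RHS]E2 b30 b40; ring.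
by rewrite b02 b20 b30 b40.
Qed.

Lemma no_opposite_eigenvectors_elliptic m : m = g0_plus \/ m = g0_minus ->
  ~ has_opposite_eigenvectors (ds_alg R m).
Proof.
move=> mE [a [b [b' [b0 b'0 ab ab']]]].
have [a0 [a1 [a2 [a3 [a4 aE]]]]] := vec5E a.
have a1_gt0 : 0 < a1.
  by apply: (@eigenvalue1_elliptic m a0 a1 a2 a3 a4 b mE b0); rewrite -aE.
have : 0 < - a1.
  apply: (@eigenvalue1_elliptic m (- a0) _ (- a2) (- a3) (- a4) b' mE b'0).
  by rewrite -vec5N -aE bracketNl ab' opprK.
by rewrite oppr_gt0 ltNge ltW.
Qed.

Lemma ds_alg_injective (g : lieAlgType R) m m' :
  lie_isomorphic g (ds_alg R m) -> lie_isomorphic g (ds_alg R m') -> m = m'.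
Proof.
move=> gm gm'.
have D : derived_class2 (ds_alg R m) <-> derived_class2 (ds_alg R m').
  by rewrite -(derived_class2_iso gm) (derived_class2_iso gm').
have E : has_opposite_eigenvectors (ds_alg R m) <-> has_opposite_eigenvectors (ds_alg R m').
  by rewrite -(has_opposite_eigenvectors_iso gm) (has_opposite_eigenvectors_iso gm').
have D0 k : k = g0_plus \/ k = g1_plus -> ~ derived_class2 (ds_alg R k).
  by case=> ->; apply: derived_class2_plus; rewrite // !inE eqxx ?orbT.
have D1 k : k = g0_minus \/ k = g1_minus -> derived_class2 (ds_alg R k).
  by case=> ->; apply: derived_class2_minus.
have E0 := no_opposite_eigenvectors_elliptic.
have E1 k : k = g1_plus \/ k = g1_minus -> has_opposite_eigenvectors (ds_alg R k).
  by case=> ->; apply: has_opposite_eigenvectors_hyperbolic.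
clear gm gm'; case: m m' D E => [] [] // D E.
all: have := (D0 _ (or_introl erefl), D0 _ (or_intror erefl)).
all: have := (D1 _ (or_introl erefl), D1 _ (or_intror erefl)).
all: have := (E0 _ (or_introl erefl), E0 _ (or_intror erefl)).
all: have := (E1 _ (or_introl erefl), E1 _ (or_intror erefl)).
all: case=> ? ?; case=> ? ?; case=> ? ?; case=> ? ?.
all: tauto.
Qed.

End ModelInvariants.

(** * The classification *)

Theorem proposition5p10 (R : realType) (g : lieAlgType R)
    (eta : 'Hom(g, R^o))
    (hdim : \dim {:g} = 5%N)
    (hDS : DS_contact eta)
    (hcenter : trivial_center g) :
  exists! m : ds_model, lie_isomorphic g (ds_alg R m).
Proof.
have [ct [xi [reeb [ds _]]]] := hDS.
have [e [e_xi e_br nondeg]] := contact_reeb_data ct reeb.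
have [xi' [x [w [u [v [d [h [c [k [d0 hck sf]]]]]]]]]] :=
  ds_split_form hdim e_xi e_br nondeg ds hcenter.
have [m gm] := split_form_ds_model hdim d0 hck sf.
by exists m; split=> // m'; apply: ds_alg_injective.
Qed.
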